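(* Assume the Riemann Hypothesis. Let $\psi(x)=\sum_{n\le x}\Lambda(n)$, where $\Lambda$ is the von Mangoldt function. Let $\epsilon>0$ and suppose there are absolute constants $A,B>1$ such that for every even positive integer $k$, $$\int_{1}^{X} (\psi(x+\delta x) - \psi(x) - \delta x)^k\, dx = \frac{\Gamma(k+1)}{\Gamma(\frac{k}{2}+2) 2^{k/2}} X^{k/2 + 1} \delta^{k/2} \Bigl(\log{\frac{1}{\delta}}\Bigr)^{k/2} + O\bigl(A^{B^k} X^{k/2+1} \delta^{k/2} (\log X)^{k/2-1}\bigr)$$ uniformly for $X^{-1+\epsilon} \leq \delta \leq X^{-\epsilon}$. Let $n$ be a positive odd integer, and suppose that $$\int_{1}^{X} (\psi(x+\delta x)-\psi(x)-\delta x)^n\, dx = o\Bigl(X^{n/2+1} \delta^{n/2} \bigl(\log\tfrac{1}{\delta}\bigr)^{n/2}\Bigr)$$ uniformly for $X^{-1+\epsilon} \leq \delta \leq X^{-\epsilon}$ as $X\to\infty$. Then for some $\epsilon_1 > 0$, $$\int_{1}^{X} (\psi(x+h)-\psi(x)-h)^n\, dx = o\bigl(X h^{n/2} (\log{X})^{n/2}\bigr)$$ uniformly for $X^{2\epsilon + \epsilon_1} \leq h \leq X^{1-(n/2+1) \epsilon - 2\epsilon_1} / 2$ as $X\to\infty$.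
   Context: $\Gamma$ is the gamma function; the implied constant in the $O$-term of the even-moment hypothesis is independent of $k$, $X$, $\delta$. *)

(* Defs.v *)
From HB Require Import structures.
From mathcomp Require Import all_boot all_order all_algebra.
From mathcomp Require Import complex.
From mathcomp Require Import all_classical all_reals all_analysis.

Set Implicit Arguments.
Unset Strict Implicit.
Unset Printing Implicit Defensive.

Import Order.TTheory GRing.Theory Num.Theory.
Import numFieldNormedType.Exports.

Local Open Scope classical_set_scope.
Local Open Scope ring_scope.
Local Open Scope complex_scope.

Definition Gamma {R : realType} (s : R) : R :=
  \int[lebesgue_measure]_(t in `]0, +oo[) (t `^ (s - 1) * expR (- t)).

(* [primes n] is a singleton [:: p] exactly when n = p ^ j with p prime and
   j >= 1; see [vonMangoldt_pX] and [vonMangoldt_neq0]. *)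
Definition vonMangoldt {R : realType} (n : nat) : R :=
  if primes n is [:: p] then ln p%:R else 0.

Lemma vonMangoldt_pX (R : realType) (p j : nat) :
  prime p -> (0 < j)%N -> vonMangoldt (p ^ j) = ln p%:R :> R.
Proof. by move=> pp j0; rewrite /vonMangoldt primesX // primes_prime. Qed.

Lemma vonMangoldt_neq0 (R : realType) (n : nat) :
  vonMangoldt n != 0 :> R ->
  exists p j, [/\ prime p, (0 < j)%N & n = (p ^ j)%N].
Proof.
rewrite /vonMangoldt; case En: (primes n) => [|p [|q s]]; rewrite ?eqxx// => _.
have : p \in primes n by rewrite En mem_head.
rewrite mem_primes => /and3P[pp n0 pn]; exists p, (logn p n); split => //.
  by rewrite logn_gt0 mem_primes pp n0.
by rewrite [LHS]prod_prime_decomp// prime_decompE En big_seq1.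
Qed.

Definition psi {R : realType} (x : R) : R :=
  \sum_(1 <= m < (Num.truncn x).+1) vonMangoldt m.

Section RiemannHypothesis.
Context {R : realType}.

Definition cexp (z : R[i]) : R[i] :=
  (expR (complex.Re z) * cos (complex.Im z)) +i* (expR (complex.Re z) * sin (complex.Im z)).

(* [zeta] is holomorphic on C \ {1} and equal to \sum_{m >= 1} m^-s for
   Re s > 1; this determines it away from s = 1. Since the topology and the
   field of scalars are those of R[i]^o, [derivable zeta s 1] is complex
   differentiability at s. *)
Definition is_riemann_zeta (zeta : R[i]^o -> R[i]^o) : Prop :=
  (forall s : R[i]^o, s != 1 -> derivable zeta s (1 : R[i]^o)) /\
  (forall s : R[i]^o, 1 < complex.Re s ->
     series (fun m : nat => cexp (- s * (ln m.+1%:R)%:C) : R[i]^o) @ \oo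
       --> zeta s).

(* The point s = 1 is the pole, where the value of [zeta] is irrelevant; the
   numbers -2, -4, -6, ... are the trivial zeros. *)
Definition riemann_hypothesis : Prop :=
  exists2 zeta : R[i]^o -> R[i]^o, is_riemann_zeta zeta &
    forall s : R[i]^o, s != 1 -> zeta s = 0 ->
      ~ (exists m : nat, s = - (2 * m.+1)%:R) -> complex.Re s = 2^-1.

End RiemannHypothesis.
Arguments riemann_hypothesis R : clear implicits.

Section Moments.
Context {R : realType}.
Implicit Types (X delta h : R) (k : nat).

Definition moment_ratio k X delta : R :=
  \int[lebesgue_measure]_(x in `[1, X])
    (psi (x + delta * x) - psi x - delta * x) ^+ k.

Definition moment_fixed k X h : R :=
  \int[lebesgue_measure]_(x in `[1, X]) (psi (x + h) - psi x - h) ^+ k.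

Definition delta_range (eps X delta : R) : Prop :=
  X `^ (-1 + eps) <= delta <= X `^ (- eps).

(* Neither the implied constant C nor the threshold for X depends on k or
   delta. The estimate cannot be asked for all X > 1: as X -> 1 the integral is
   of order X - 1, which exceeds every term on the right when k >= 6. *)
Definition even_moments_hypothesis (eps : R) : Prop :=
  exists A B C : R, 1 < A /\ 1 < B /\
    \forall X \near +oo, forall (k : nat) (delta : R),
      (0 < k)%N -> ~~ odd k -> delta_range eps X delta ->
      `| moment_ratio k X delta
         - Gamma (k%:R + 1) / (Gamma (k%:R / 2 + 2) * 2 `^ (k%:R / 2))
           * X `^ (k%:R / 2 + 1) * delta `^ (k%:R / 2)
           * ln (1 / delta) `^ (k%:R / 2) |
      <= C * (A `^ (B ^+ k) * X `^ (k%:R / 2 + 1) * delta `^ (k%:R / 2)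
              * ln X `^ (k%:R / 2 - 1)).

Definition odd_moment_hypothesis (eps : R) (n : nat) : Prop :=
  forall eta : R, 0 < eta ->
    \forall X \near +oo, forall delta : R, delta_range eps X delta ->
      `| moment_ratio n X delta |
      <= eta * (X `^ (n%:R / 2 + 1) * delta `^ (n%:R / 2)
                * ln (1 / delta) `^ (n%:R / 2)).

Definition odd_moment_conclusion (eps eps1 : R) (n : nat) : Prop :=
  forall eta : R, 0 < eta ->
    \forall X \near +oo, forall h : R,
      X `^ (2 * eps + eps1) <= h
        <= X `^ (1 - (n%:R / 2 + 1) * eps - 2 * eps1) / 2 ->
      `| moment_fixed n X h |
      <= eta * (X * h `^ (n%:R / 2) * ln X `^ (n%:R / 2)).

End Moments.

(* Main.v *)
(* Write E(x) = psi(x) - x. Since E(x) + x is nondecreasing, the even moments of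
   E((1 + delta) x) - E(x), available for all delta in a range, control by dyadic
   chaining (Rademacher-Menshov) the maximal function of E(y) - E(x) over
   x <= y <= (1 + delta) x, with the square-root dependence on delta intact.
   For fixed h, cut [1, X] into pieces [y, (1 + c) y] with c small and compare
   E(x + h) - E(x) on each of them with E((1 + delta) x) - E(x), where
   delta = h / ((1 + c) y): the moment of the latter is small by hypothesis, and
   the difference E(x + h) - E((1 + delta) x) is an increment of length at most
   c h, hence smaller by a factor c^(1/2) in mean. This works as long as
   h <= y^(1 - eps) / 24. For smaller x, averaging the maximal function over
   short intervals yields the pointwise bound h^((1 + eps) / 2 + o(1)) for
   E(x + h) - E(x), which suffices in the stated range of h. *)

(* An odd moment is small only through cancellation, so it cannot be localised by absolute values:
   on a block it is the difference of the moments over [1, (1 + c) y] and [1, y], each known only up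
   to a small multiple of y in normalised units. Hence c is fixed before X tends to infinity, and
   the odd hypothesis is invoked with a tolerance proportional to c. The even moments enter at two
   unrelated orders. Order 2(n + 1) serves the comparison: the discrepancy contributes about c^(n+1)
   y on a block of length c y, which is a gain because n + 1 is at least 2. Order 2p, with p large
   in terms of [eps] and [eps1], serves the pointwise bound, whose loss fades as p grows. The lower
   end of the range of h reflects where the chain has to stop: ratios below 1 + Z^(-1+eps) are
   outside the hypothesis, so the last increment, of size Z^eps, is controlled only by monotonicity.
   It is harmless when small against sqrt(h), that is, for h well above X^(2 eps). *)
From HB Require Import structures.
Require Import Defs.
From mathcomp Require Import all_boot all_order all_algebra.
From mathcomp Require Import complex.
From mathcomp Require Import all_classical all_reals all_analysis.
From mathcomp Require Import measurable_realfun ring lra zify.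

Import Order.TTheory GRing.Theory Num.Theory.
Import numFieldNormedType.Exports.

Local Open Scope classical_set_scope.
Local Open Scope ring_scope.

(** * Integrals of locally bounded measurable functions over compact intervals *)

Section Integrals.
Set Implicit Arguments.
Unset Strict Implicit.
Unset Printing Implicit Defensive.
Context {R : realType}.
Implicit Types (f g : R -> R) (a b c x y : R).

Notation mu := (@lebesgue_measure R).

(** Unlike integrability, this class is stable under products, powers and composition, and it
    contains the discontinuous [psi]; integrability side conditions thus reduce to closure rules. *)
Definition locally_bounded_measurable f :=
  measurable_fun [set: R] f /\
  forall A : R, exists M : R, forall x, `|x| <= A -> `|f x| <= M.

Notation lbm := locally_bounded_measurable.

Lemma lbm_cst (c : R) : lbm (fun=> c).
Proof. by split; [exact: measurable_cst|move=> A; exists `|c|]. Qed.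

Lemma lbm_add f g : lbm f -> lbm g -> lbm (fun x => f x + g x).
Proof.
move=> [mf bf] [mg bg]; split; first exact: measurable_funD.
move=> A; have [M fM] := bf A; have [N gN] := bg A.
exists (M + N) => x xA; apply: (le_trans (ler_normD _ _)).
by rewrite lerD ?fM ?gN.
Qed.

Lemma lbm_mul f g : lbm f -> lbm g -> lbm (fun x => f x * g x).
Proof.
move=> [mf bf] [mg bg]; split; first exact: measurable_funM.
move=> A; have [M fM] := bf A; have [N gN] := bg A.
by exists (M * N) => x xA; rewrite normrM ler_pM ?fM ?gN.
Qed.

Lemma lbm_scale (c : R) f : lbm f -> lbm (fun x => c * f x).
Proof. by move=> bf; apply: lbm_mul => //; exact: lbm_cst. Qed.

Lemma lbm_sub f g : lbm f -> lbm g -> lbm (fun x => f x - g x).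
Proof.
move=> bf bg; rewrite (_ : (fun x => _) = fun x => f x + -1 * g x).
  by apply: lbm_add => //; exact: lbm_scale.
by apply/funext => x; rewrite mulN1r.
Qed.

Lemma lbm_exp f n : lbm f -> lbm (fun x => f x ^+ n).
Proof.
move=> bf; elim: n => [|n IH]; first by under eq_fun do rewrite expr0; exact: lbm_cst.
by under eq_fun do rewrite exprS; exact: lbm_mul.
Qed.

Lemma lbm_norm f : lbm f -> lbm (fun x => `|f x|).
Proof.
move=> [mf bf]; split; first exact: measurableT_comp.
by move=> A; have [M fM] := bf A; exists M => x xA; rewrite normr_id fM.
Qed.

Lemma lbm_comp f g : lbm f -> lbm g -> lbm (fun x => f (g x)).
Proof.
move=> [mf bf] [mg bg]; split; first exact: measurableT_comp.
move=> A; have [M gM] := bg A; have [N fN] := bf M.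
by exists N => x xA; rewrite fN// gM.
Qed.

Lemma nondecreasing_lbm f : {homo f : x y / x <= y} -> lbm f.
Proof.
move=> ndf; split; first exact: nondecreasing_measurable.
move=> A; exists (`|f A| + `|f (- A)|) => x; rewrite ler_norml => /andP[Ax xA].
have := ler_norm (f A); have := ler_norm (- f (- A)); rewrite normrN.
have := ndf _ _ Ax; have := ndf _ _ xA; have := normr_ge0 (f A).
have := normr_ge0 (f (- A)); rewrite ler_norml => *; apply/andP; split; lra.
Qed.

Lemma lbm_id : lbm id.
Proof. by apply: nondecreasing_lbm. Qed.

Lemma lbm_scaled f (c : R) : lbm f -> lbm (fun x => f (c * x)).
Proof. by move=> bf; apply: (@lbm_comp f (fun x => c * x)) => //; apply: lbm_scale; exact: lbm_id. Qed.

Lemma lbm_integrable f a b : lbm f -> mu.-integrable `[a, b] (EFin \o f).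
Proof.
move=> [mf bf]; apply: measurable_bounded_integrable => //.
- by have /= := lebesgue_measure_itv `[a, b]%R; rewrite -EFinB => ->; case: ifP => _;
   rewrite ltry.
- exact: measurable_funTS.
- have [M fM] := bf (`|a| + `|b|); exists M; split; first exact: num_real.
  move=> N MN x /=; rewrite in_itv/= => /andP[ax xb].
  apply: le_trans (ltW MN); apply: fM; rewrite ler_norml; apply/andP; split.
    have := ler_norm (- a); rewrite normrN; have := normr_ge0 b; lra.
  have := ler_norm b; have := normr_ge0 a; lra.
Qed.

Lemma Rintegral_itv_cst a b c : a <= b ->
  \int[mu]_(x in `[a, b]) c = (b - a) * c.
Proof.
move=> ab; rewrite Rintegral_cst//= mulrC; congr (_ * _).
have /= -> := lebesgue_measure_itv `[a, b]%R; rewrite lte_fin; case: ltP => //= ba.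
by apply/eqP; rewrite eq_sym subr_eq0 eq_le ab ba.
Qed.

Lemma le_Rintegral_itv f g a b : lbm f -> lbm g ->
  (forall x, a <= x -> x <= b -> f x <= g x) ->
  \int[mu]_(x in `[a, b]) f x <= \int[mu]_(x in `[a, b]) g x.
Proof.
move=> bf bg fg; apply: le_Rintegral => //; try exact: lbm_integrable.
by move=> x /=; rewrite in_itv/= => /andP[]; exact: fg.
Qed.

Lemma Rintegral_itvD f g a b : lbm f -> lbm g ->
  \int[mu]_(x in `[a, b]) (f x + g x) =
  \int[mu]_(x in `[a, b]) f x + \int[mu]_(x in `[a, b]) g x.
Proof. by move=> bf bg; apply: RintegralD => //; exact: lbm_integrable. Qed.

Lemma Rintegral_itvZ f a b c : lbm f ->
  \int[mu]_(x in `[a, b]) (c * f x) = c * \int[mu]_(x in `[a, b]) f x.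
Proof. by move=> bf; apply: RintegralZl => //; exact: lbm_integrable. Qed.

Lemma Rintegral_itv_split f a b c : lbm f -> a <= b -> b <= c ->
  \int[mu]_(x in `[a, c]) f x =
  \int[mu]_(x in `[a, b]) f x + \int[mu]_(x in `[b, c]) f x.
Proof.
move=> bf ab bc; have fi := lbm_integrable a c bf.
have := @Rintegral_itvB _ f (BLeft a) (BRight c) b fi.
rewrite !bnd_simp => /(_ ab bc) /eqP; rewrite subr_eq => /eqP ->.
rewrite addrC; congr (_ + _); apply: Rintegral_itv_obnd_cbnd.
by apply: (integrableS _ _ _ (lbm_integrable b c bf)) => //; exact: subset_itv_oc_cc.
Qed.

Lemma normr_Rintegral_itv f a b : lbm f ->
  `|\int[mu]_(x in `[a, b]) f x| <= \int[mu]_(x in `[a, b]) `|f x|.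
Proof. by move=> bf; apply: le_normr_Rintegral => //; exact: lbm_integrable. Qed.

Lemma Rintegral_itv_ge0 f a b : (forall x, 0 <= f x) ->
  0 <= \int[mu]_(x in `[a, b]) f x.
Proof. by move=> f0; apply: Rintegral_ge0. Qed.

Lemma Rintegral_itv_subset f a b c d : lbm f -> (forall x, 0 <= f x) ->
  a <= b -> b <= c -> c <= d ->
  \int[mu]_(x in `[b, c]) f x <= \int[mu]_(x in `[a, d]) f x.
Proof.
move=> bf f0 ab bc cd; rewrite (@Rintegral_itv_split f a b d)//; last exact: le_trans cd.
rewrite (@Rintegral_itv_split f b c d)//.
have := Rintegral_itv_ge0 a b f0; have := Rintegral_itv_ge0 c d f0; lra.
Qed.

(** The right-hand side is itself a measure in [A], a rescaled pushforward, and it gives half-open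
    intervals their length; this characterises Lebesgue measure. *)
Lemma lebesgue_measure_scale (c : R) (A : set R) : 0 < c -> measurable A ->
  (mu A = c%:E * mu ((fun x : R => (c * x)%R : measurableTypeR R) @^-1` A))%E.
Proof.
move=> c0 mA; pose phi (x : R) := (c * x : measurableTypeR R).
have mphi : measurable_fun [set: R] phi by exact: measurable_funM.
pose s : {nonneg R} := NngNum (ltW c0).
have [m mE] : exists m : {measure set (measurableTypeR R) -> \bar R},
    forall B, (m B = c%:E * mu (phi @^-1` B))%E.
  unshelve eexists (mscale s (pushforward mu phi)); [exact: mphi|by []].
rewrite -[RHS]mE; apply: lebesgue_measure_unique => // _ [[u v]] _ <-; rewrite [RHS]mE/=.
have -> : phi @^-1` `]u, v] = `]u / c, v / c]%classic.
  apply/seteqP; split => x /=; rewrite !in_itv/= /phi;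
  by rewrite ltr_pdivrMr// ler_pdivlMr// ![x * c]mulrC.
have /= -> := lebesgue_measure_itv `]u, v]%R.
have /= -> := lebesgue_measure_itv `]u / c, v / c]%R.
rewrite !lte_fin ltr_pM2r ?invr_gt0//; case: ltP => _; last by rewrite mule0.
by rewrite -!EFinB -EFinM -mulrBl mulrC divfK// gt_eqF.
Qed.

Lemma ge0_Rintegral_itv_scale f a b c : lbm f -> (forall x, 0 <= f x) -> 0 < c ->
  \int[mu]_(x in `[c * a, c * b]) f x = c * \int[mu]_(x in `[a, b]) f (c * x).
Proof.
move=> [mf bf] f0 c0; pose phi (x : R) := (c * x : measurableTypeR R).
have mphi : measurable_fun [set: R] phi by exact: measurable_funM.
pose s : {nonneg R} := NngNum (ltW c0).
rewrite -Rintegral_itvZ; last first.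
  by apply: (@lbm_comp f) => //; apply: lbm_scale; exact: lbm_id.
rewrite /Rintegral; congr fine; apply/esym.
have mfD : measurable_fun `[c * a, c * b] (fun x => (f x)%:E).
  by apply/measurable_EFinP; exact: measurable_funTS.
have phiE : `[a, b]%classic = phi @^-1` `[c * a, c * b].
  by apply/seteqP; split => x /=; rewrite !in_itv/= !ler_pM2l.
under eq_integral do rewrite EFinM.
rewrite ge0_integralZl//; first last.
- by rewrite lee_fin ltW.
- by move=> x _; rewrite lee_fin.
- apply/measurable_EFinP; apply: measurable_funTS.
  by apply: measurableT_comp.
rewrite phiE.
have -> : (\int[mu]_(x in phi @^-1` `[(c * a)%R, (c * b)%R]) (f (c * x))%:E =
  \int[mu]_(x in phi @^-1` `[(c * a)%R, (c * b)%R]) ((EFin \o f) \o phi) x)%E by [].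
rewrite -ge0_integral_pushforward//=; last by move=> x _; rewrite lee_fin.
rewrite -[c]/(s%:num) -ge0_integral_mscale//; last by move=> x _; rewrite lee_fin.
apply: eq_measure_integral => A mA _; rewrite /mscale/= /pushforward.
apply/esym; exact: lebesgue_measure_scale.
Qed.

(** Change of variables with the Jacobian 1/c, at most 1, thrown away. It handles increments based
    at a multiple of x. *)
Lemma ge0_Rintegral_itv_dilate f a b c : lbm f -> (forall x, 0 <= f x) -> 1 <= c ->
  \int[mu]_(x in `[a, b]) f (c * x) <= \int[mu]_(x in `[c * a, c * b]) f x.
Proof.
move=> bf f0 c1; rewrite ge0_Rintegral_itv_scale//; last exact: lt_le_trans c1.
by rewrite ler_peMl// Rintegral_itv_ge0.
Qed.

End Integrals.
Notation lbm := locally_bounded_measurable.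

(** * Dyadic chaining along geometric progressions *)

Section Chaining.
Set Implicit Arguments.
Unset Strict Implicit.
Unset Printing Implicit Defensive.
Context {R : realType}.
Implicit Types (x y a b c r s V Z : R) (k n p J q : nat).

Notation mu := (@lebesgue_measure R).

Lemma exprD_le (k : nat) (a b : R) : 0 <= a -> 0 <= b ->
  (a + b) ^+ k <= 2 ^+ k * (a ^+ k + b ^+ k).
Proof.
move=> a0 b0; wlog ab : a b a0 b0 / b <= a.
  by move=> H; have [/H->//|/ltW/H] := leP b a; rewrite addrC [a ^+ _ + _]addrC; exact.
apply: (@le_trans _ _ ((2 * a) ^+ k)).
  by rewrite lerXn2r ?nnegrE ?addr_ge0 ?mulr_ge0//; lra.
by rewrite exprMn ler_wpM2l ?exprn_ge0// lerDl exprn_ge0.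
Qed.

(** Case split at a = 6b. The coefficient of the first power stays close to 1 because the chain
    iterates the inequality at every level with the recursive part as [a]; the large factor only
    hits the new increment [b]. *)
Lemma exprD_le_split (k : nat) (a b : R) : 0 <= a -> 0 <= b ->
  (a + b) ^+ k <= (7 / 6) ^+ k * a ^+ k + 7 ^+ k * b ^+ k.
Proof.
move=> a0 b0; rewrite -!exprMn; have [ab|ab] := leP (6 * b) a.
  apply: (@le_trans _ _ ((7 / 6 * a) ^+ k)); last by rewrite lerDl exprn_ge0// mulr_ge0.
  by rewrite lerXn2r ?nnegrE ?addr_ge0 ?mulr_ge0//; lra.
apply: (@le_trans _ _ ((7 * b) ^+ k)).
  by rewrite lerXn2r ?nnegrE ?addr_ge0 ?mulr_ge0//; lra.
by rewrite lerDr exprn_ge0// mulr_ge0//; lra.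
Qed.

(** Convergence criterion of the chain: one more level doubles the number of terms and costs
    (7/6)^(2p), while doubling the step multiplies the moment bound by 2^p. It fails for p = 1. *)
Lemma chaining_ratio_lt p : (2 <= p)%N -> 2 * ((7 / 6) ^+ (2 * p)) < 2 ^+ p :> R.
Proof.
case: p => [|[|p]]// _; rewrite exprM; have -> : ((7 / 6) ^+ 2 : R) = 49 / 36 by field.
elim: p => [|p IH]; first by rewrite !expr2; lra.
rewrite exprS [ltRHS]exprS; have : 0 < (49 / 36 : R) ^+ p.+2 by rewrite exprn_gt0//; lra.
lra.
Qed.

Context (E : R -> R) (E_lower : forall x y, x <= y -> E x - E y <= y - x).

Lemma lower_lipschitz_lbm : lbm E.
Proof.
have -> : E = fun x => (E x + x) - x by apply/funext => x; rewrite addrK.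
apply: lbm_sub; last exact: lbm_id.
by apply: nondecreasing_lbm => x y xy; have := E_lower xy; lra.
Qed.

Lemma increment_lbm k c : lbm (fun x => `|E (c * x) - E x| ^+ k).
Proof.
apply: lbm_exp; apply: lbm_norm; apply: lbm_sub; last exact: lower_lipschitz_lbm.
by apply: lbm_scaled; exact: lower_lipschitz_lbm.
Qed.

(** Dominates the maximum over q <= 2^J of |E(r^q x) - E(x)|^k (for k > 0). The maximum over the two
    halves of the progression is replaced by a sum, which can be integrated level by level. *)
Fixpoint dyadic_majorant k r J x : R :=
  if J is J'.+1 then
    (7 / 6) ^+ k * (dyadic_majorant k r J' x +
                    dyadic_majorant k r J' (r ^+ (2 ^ J') * x)) +
    7 ^+ k * `|E (r ^+ (2 ^ J') * x) - E x| ^+ k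
  else `|E (r * x) - E x| ^+ k.

Lemma dyadic_majorant_ge0 k r J x : 0 <= dyadic_majorant k r J x.
Proof.
elim: J x => [|J IH] x /=; first exact: exprn_ge0.
by rewrite addr_ge0// mulr_ge0 ?exprn_ge0 ?addr_ge0 ?IH//; lra.
Qed.

Lemma dyadic_majorant_lbm k r J : lbm (dyadic_majorant k r J).
Proof.
elim: J => [|J IH] /=; first exact: increment_lbm.
apply: lbm_add; last by apply: lbm_scale; exact: increment_lbm.
by apply: lbm_scale; apply: lbm_add => //; exact: lbm_scaled.
Qed.

Lemma dyadic_majorantP k r J x q : (0 < k)%N -> (q <= 2 ^ J)%N ->
  `|E (r ^+ q * x) - E x| ^+ k <= dyadic_majorant k r J x.
Proof.
move=> k0; elim: J x q => [|J IH] x q /=.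
  case: q => [|[|]]// _; rewrite ?expr1//.
  by rewrite expr0 mul1r subrr normr0 expr0n eqn0Ngt k0 exprn_ge0.
have G0 := dyadic_majorant_ge0.
have c1 : (1 : R) <= (7 / 6) ^+ k by rewrite exprn_ege1//; lra.
have [qJ _|qJ qJ1] := leqP q (2 ^ J).
  apply: (le_trans (IH _ _ qJ)).
  apply: (@le_trans _ _ ((7 / 6) ^+ k * dyadic_majorant k r J x)).
    by rewrite ler_peMl.
  by rewrite mulrDr -addrA lerDl addr_ge0// mulr_ge0 ?exprn_ge0//; lra.
have -> : q = (q - 2 ^ J + 2 ^ J)%N by rewrite subnK// ltnW.
rewrite exprD -mulrA; set w := r ^+ (2 ^ J) * x; set q' := (q - _)%N.
have q'J : (q' <= 2 ^ J)%N by rewrite /q' leq_subLR addnn -mul2n -expnS.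
apply: (@le_trans _ _ ((`|E (r ^+ q' * w) - E w| + `|E w - E x|) ^+ k)).
  rewrite lerXn2r ?nnegrE ?addr_ge0//.
  by rewrite (le_trans _ (ler_normD _ _))// addrA subrK.
apply: (le_trans (exprD_le_split k (normr_ge0 _) (normr_ge0 _))).
rewrite lerD2r ler_wpM2l ?(le_trans _ c1)//.
by apply: (le_trans (IH _ _ q'J)); rewrite lerDr.
Qed.

(** The quotient is the solution C of 7^(2p) + 2 (7/6)^(2p) C = 2^p C, so the bound reproduces
    itself from one level to the next; the added 1 gives C >= 1 for the base level. *)
Definition chaining_const p : R :=
  7 ^+ (2 * p) / (2 ^+ p - 2 * (7 / 6) ^+ (2 * p)) + 1.

Lemma chaining_const_ge1 p : (2 <= p)%N -> 1 <= chaining_const p.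
Proof.
move=> p2; rewrite lerDr divr_ge0 ?exprn_ge0// subr_ge0.
by apply: ltW; exact: chaining_ratio_lt.
Qed.

Lemma chaining_constP p : (2 <= p)%N ->
  7 ^+ (2 * p) + 2 * (7 / 6) ^+ (2 * p) * chaining_const p <=
  2 ^+ p * chaining_const p.
Proof.
move=> p2; have := chaining_ratio_lt p2.
rewrite -lerBrDr -mulrBl -subr_gt0 /chaining_const => H.
by rewrite mulrDr mulr1 mulrCA mulfV ?gt_eqF// mulr1 lerDl ltW.
Qed.

(** With t = r^(2^J) the two sides differ by (t - 1)^2. This doubling is the source of the factor
    2^p in the convergence criterion. *)
Lemma dyadic_ratio_ge r J : 1 <= r ->
  2 * (r ^+ (2 ^ J) - 1) <= r ^+ (2 ^ J.+1) - 1.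
Proof.
move=> r1; rewrite expnS mulnC exprM; have := exprn_ege1 (2 ^ J) r1.
set t := r ^+ _ => t1; rewrite expr2; have := sqr_ge0 (t - 1); rewrite expr2; lra.
Qed.

(** Induction on [J]. The second half of the chain is based at t x, and dilation turns its integral
    into one over [t a, t b]; hence the interval is arbitrary and only its reach r^(2^J) b is
    limited by [Z]. *)
Lemma Rintegral_dyadic_majorant p r J V Z a b : (2 <= p)%N -> 1 <= r -> 0 <= V ->
  (forall j, (j <= J)%N ->
     \int[mu]_(x in `[1, Z]) (`|E (r ^+ (2 ^ j) * x) - E x| ^+ (2 * p)) <=
       V * (r ^+ (2 ^ j) - 1) ^+ p) ->
  1 <= a -> a <= b -> r ^+ (2 ^ J) * b <= Z ->
  \int[mu]_(x in `[a, b]) dyadic_majorant (2 * p) r J x <=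
    chaining_const p * V * (r ^+ (2 ^ J) - 1) ^+ p.
Proof.
move=> p2 r1 V0; have C1 := chaining_const_ge1 p2; set C := chaining_const p in C1 *.
have rj1 j : 1 <= r ^+ j by exact: exprn_ege1.
have incr j u v : 1 <= u -> u <= v -> r ^+ (2 ^ j) * v <= Z ->
    \int[mu]_(x in `[u, v]) (`|E (r ^+ (2 ^ j) * x) - E x| ^+ (2 * p)) <=
    \int[mu]_(x in `[1, Z]) (`|E (r ^+ (2 ^ j) * x) - E x| ^+ (2 * p)).
  move=> u1 uv vZ; apply: Rintegral_itv_subset => //; first exact: increment_lbm.
  apply: le_trans vZ; rewrite ler_peMl//; lra.
elim: J a b => [|J IH] a b mom a1 ab bZ /=.
  apply: (le_trans (incr 0%N a b a1 ab bZ)); apply: (le_trans (mom 0%N isT)).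
  by rewrite ler_wpM2r ?exprn_ge0 ?subr_ge0// ler_peMl.
set t := r ^+ (2 ^ J) in incr bZ *; have t1 : 1 <= t := rj1 _.
have rt : r ^+ (2 ^ J.+1) = t * t by rewrite expnS mulnC exprM expr2.
rewrite rt in bZ *.
have bZ' : t * b <= Z by apply: le_trans bZ; rewrite ler_wpM2r ?ler_peMl//; lra.
have H1 := IH a b (fun j jJ => mom j (leqW jJ)) a1 ab bZ'.
have H2 : \int[mu]_(x in `[a, b]) dyadic_majorant (2 * p) r J (t * x) <=
    C * V * (t - 1) ^+ p.
  apply: (le_trans (ge0_Rintegral_itv_dilate _ _ (dyadic_majorant_lbm _ r J)
    (dyadic_majorant_ge0 _ r J) t1)).
  apply: IH; first by move=> j jJ; apply: mom; exact: leqW.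
  - by rewrite (le_trans a1)// ler_peMl//; lra.
  - by rewrite ler_wpM2l//; lra.
  - by rewrite -/t mulrA.
have H3 := le_trans (incr J a b a1 ab bZ') (mom J (leqnSn J)); rewrite -/t in H3.
have bG := dyadic_majorant_lbm (2 * p) r J.
have bG' : lbm (fun x => dyadic_majorant (2 * p) r J (t * x)) by exact: lbm_scaled.
have bI := increment_lbm (2 * p) t.
rewrite Rintegral_itvD; first last.
- exact: lbm_scale.
- by apply: lbm_scale; exact: lbm_add.
rewrite !Rintegral_itvZ//; last exact: lbm_add.
rewrite Rintegral_itvD//.
have D0 : 0 <= (t - 1) ^+ p by rewrite exprn_ge0// subr_ge0.
apply: (@le_trans _ _ ((7 / 6) ^+ (2 * p) * (C * V * (t - 1) ^+ p + C * V * (t - 1) ^+ p)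
   + 7 ^+ (2 * p) * (V * (t - 1) ^+ p))).
  have c0 : 0 <= (7 / 6 : R) ^+ (2 * p) by rewrite exprn_ge0.
  apply: lerD; first by apply: ler_wpM2l => //; exact: lerD.
  by rewrite ler_wpM2l ?exprn_ge0.
apply: (@le_trans _ _ (C * V * (2 * (t - 1)) ^+ p)); last first.
  have CV0 : 0 <= C * V by rewrite mulr_ge0// (le_trans _ C1).
  rewrite ler_wpM2l// lerXn2r ?nnegrE ?mulr_ge0 ?subr_ge0//.
    by rewrite -[1]mulr1 ler_pM.
  by have := dyadic_ratio_ge J r1; rewrite rt.
rewrite [X in _ <= _ * X]exprMn; have := chaining_constP p2; rewrite -/C.
move=> /(ler_wpM2r (mulr_ge0 V0 D0)); set s := (t - 1) ^+ p; set m := (7 / 6) ^+ _.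
set m7 := 7 ^+ _; set w := 2 ^+ _; lra.
Qed.

Lemma geometric_locate r x y N : x <= y -> y < r ^+ N * x ->
  exists2 q, (q < N)%N & r ^+ q * x <= y < r ^+ q.+1 * x.
Proof.
move=> xy; elim: N => [|N IH]; first by rewrite expr0 mul1r ltNge xy.
have [yN _|Ny yN1] := ltP y (r ^+ N * x); last by exists N; rewrite ?Ny.
by have [q qN qy] := IH yN; exists q => //; exact: ltnW.
Qed.

(* Monotonicity of [E x + x] is what lets the chain stop at ratio [r]: between
   two consecutive points of the chain [E] moves by at most [Z * (r - 1)]. *)
Lemma maximal_increment k r J x y Z : (0 < k)%N -> 1 <= r -> 0 <= x ->
  x <= y -> y <= r ^+ (2 ^ J) * x -> r ^+ (2 ^ J) * x <= Z ->
  `|E y - E x| ^+ k <=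
    2 ^+ k * (dyadic_majorant k r J x + (Z * (r - 1)) ^+ k).
Proof.
move=> k0 r1 x0 xy yJ JZ; have G := @dyadic_majorantP k r J x _ k0.
have Z0 : 0 <= Z by apply: le_trans JZ; apply: le_trans yJ; exact: le_trans xy.
have s0 : 0 <= Z * (r - 1) by rewrite mulr_ge0// subr_ge0.
suff [q qJ H] : exists2 q, (q <= 2 ^ J)%N &
    `|E y - E x| <= `|E (r ^+ q * x) - E x| + Z * (r - 1).
  apply: (@le_trans _ _ ((`|E (r ^+ q * x) - E x| + Z * (r - 1)) ^+ k)).
    by rewrite lerXn2r ?nnegrE ?addr_ge0.
  apply: (le_trans (exprD_le k (normr_ge0 _) s0)).
  by rewrite ler_wpM2l ?exprn_ge0// lerD2r G.
move: yJ; rewrite le_eqVlt => /predU1P[->|yJ].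
  by exists (2 ^ J)%N; rewrite // lerDl.
have [q qJ /andP[qy yq]] := geometric_locate xy yJ.
have gap : r ^+ q.+1 * x - r ^+ q * x <= Z * (r - 1).
  rewrite exprS -mulrA -[X in _ - X]mul1r -mulrBl mulrC ler_wpM2r ?subr_ge0//.
  apply: le_trans JZ; rewrite ler_wpM2r//.
  by rewrite ler_weXn2l// ltnW.
have lo := E_lower qy; have hi := E_lower (ltW yq).
(* [E] may jump up but falls at most at unit rate: a nonnegative increment is compared with the next
   point of the chain, a negative one with the previous point. *)
have [yx|xy'] := leP 0 (E y - E x).
  exists q.+1 => //; rewrite ger0_norm//.
  have := ler_norm (E (r ^+ q.+1 * x) - E x); lra.
exists q; first exact: ltnW.
rewrite ltr0_norm//; have := ler_norm (- (E (r ^+ q * x) - E x)); rewrite normrN; lra.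
Qed.

(** Take the last level t = r^(2^J) with t - 1 <= d; the next one satisfies t^2 - 1 = (t - 1)(t + 1)
    <= 3(t - 1), since t <= 2. *)
Lemma dyadic_ratio_exists r d : 1 < r -> r - 1 <= d -> d <= 1 ->
  exists J, r ^+ (2 ^ J) - 1 <= d < 3 * (r ^+ (2 ^ J) - 1).
Proof.
move=> r1 rd d1; have [N Nd] : exists N, d < r ^+ (2 ^ N) - 1.
  have grow N : N.+1%:R * (r - 1) <= r ^+ (2 ^ N) - 1.
    elim: N => [|N IH]; first by rewrite expn0 expr1 mul1r.
    have := dyadic_ratio_ge N (ltW r1).
    have : N.+2%:R * (r - 1) <= 2 * (N.+1%:R * (r - 1)).
      rewrite mulrA; apply: ler_wpM2r; first by rewrite subr_ge0 ltW.
      by rewrite -[N.+2]addn2 -[N.+1]addn1 !natrD; have := ler0n R N; lra.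
    lra.
  have r10 : 0 < r - 1 by rewrite subr_gt0.
  exists (Num.bound (d / (r - 1))); apply: lt_le_trans (grow _).
  have d0 : 0 <= d / (r - 1) by rewrite divr_ge0//; lra.
  have := archi_boundP d0; rewrite ltr_pdivrMr// => /lt_le_trans; apply.
  by rewrite ler_wpM2r ?(ltW r10)// ler_nat.
elim: N Nd => [|N IH] Nd; first by move: Nd; rewrite expn0 expr1 ltNge rd.
have [/IH//|dN] := ltP d (r ^+ (2 ^ N) - 1); exists N; rewrite dN/=.
apply: (lt_le_trans Nd); rewrite expnS mulnC exprM.
have := exprn_ege1 (2 ^ N) (ltW r1); move: dN; set t := r ^+ _ => dN t1.
rewrite expr2; have : (t - 1) * (t + 1) <= (t - 1) * 3 by apply: ler_wpM2l; lra.
lra.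
Qed.

End Chaining.

(** * Powers and logarithms of a large parameter *)

Section Asymptotics.
Set Implicit Arguments.
Unset Strict Implicit.
Unset Printing Implicit Defensive.
Context {R : realType}.
Implicit Types (x y a b c X : R) (P Q : R -> Prop).

Definition for_large P := exists M : R, forall X, M <= X -> P X.

Lemma near_pinftyP P : (\forall X \near +oo, P X) <-> for_large P.
Proof.
split=> [[M [_ MP]]|[M MP]].
  by exists (M + 1) => X MX; apply: MP; apply: lt_le_trans MX; rewrite ltrDl.
by exists M; split; [exact: num_real|move=> X /ltW; exact: MP].
Qed.

Lemma for_large_and P Q : for_large P -> for_large Q ->
  for_large (fun X => P X /\ Q X).
Proof.
move=> [M MP] [N NQ]; exists (Num.max M N) => X.
by rewrite ge_max => /andP[MX NX]; split; [exact: MP|exact: NQ].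
Qed.

Lemma for_large_ge c : for_large (fun X => c <= X).
Proof. by exists c. Qed.

Lemma powRD_gt0 x a b : 0 < x -> x `^ (a + b) = x `^ a * x `^ b.
Proof. by move=> x0; rewrite powRD// (gt_eqF x0) implybT. Qed.

Lemma powR_exprn x a n : (x `^ a) ^+ n = x `^ (a * n%:R).
Proof. by rewrite powRrM powR_mulrn ?powR_ge0. Qed.

Lemma powR_ge1 x a : 1 <= x -> 0 <= a -> 1 <= x `^ a.
Proof. by move=> x1 a0; rewrite -(powRr0 x); exact: ler_powR. Qed.

Lemma powR_le x y a : 0 <= x -> x <= y -> 0 <= a -> x `^ a <= y `^ a.
Proof. by move=> x0 xy a0; rewrite ge0_ler_powR// nnegrE// (le_trans x0). Qed.

Lemma powR_le_neg x y a : 0 < x -> x <= y -> a <= 0 -> y `^ a <= x `^ a.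
Proof.
move=> x0 xy a0; have y0 := lt_le_trans x0 xy.
rewrite -[a]opprK !(powRN _ (- a)) lef_pV2 ?posrE ?powR_gt0//.
by apply: powR_le => //; [exact: ltW|lra].
Qed.

Lemma powR_cst_le c x a : 1 <= c -> 0 <= x -> 0 <= a -> a <= 1 ->
  (c * x) `^ a <= c * x `^ a.
Proof.
move=> c1 x0 a0 a1; rewrite powRM//; last exact: le_trans c1.
by rewrite ler_wpM2r ?powR_ge0// ler1_powR.
Qed.

Lemma for_large_powR_ge c a : 0 < a -> for_large (fun X => c <= X `^ a).
Proof.
move=> a0; exists ((1 + `|c|) `^ a^-1) => X cX.
have c0 : 0 <= 1 + `|c| by rewrite addr_ge0.
apply: (@le_trans _ _ (((1 + `|c|) `^ a^-1) `^ a)).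
  by rewrite -powRrM mulVf ?gt_eqF// powRr1//; have := ler_norm c; lra.
by apply: powR_le => //; exact: ltW.
Qed.

Lemma for_large_powR_le c a b : a < b ->
  for_large (fun X => c * X `^ a <= X `^ b).
Proof.
move=> ab; have ab0 : 0 < b - a by rewrite subr_gt0.
have [M MP] := for_large_and (for_large_powR_ge c ab0) (for_large_ge 1).
exists M => X /MP[cX X1]; rewrite -[b in leRHS](subrK a) powRD_gt0 ?(lt_le_trans _ X1)//.
by rewrite ler_wpM2r ?powR_ge0.
Qed.

Lemma for_large_ln_le a : 0 < a -> for_large (fun X => ln X <= X `^ a).
Proof.
move=> a0; have a20 : 0 < a / 2 by lra.
have [M MP] := for_large_and (for_large_powR_ge (2 / a) a20) (for_large_ge 1).
exists M => X /MP[cX X1]; have X0 : 0 < X by rewrite (lt_le_trans _ X1).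
have := ln_sublinear (powR_gt0 (a / 2) X0); rewrite ln_powR => /ltW lnX.
rewrite [a in leRHS]splitr powRD_gt0//.
apply: (@le_trans _ _ (2 / a * X `^ (a / 2))); last by apply: ler_wpM2r; rewrite ?powR_ge0.
rewrite -(ler_pM2l a20); apply: (le_trans lnX); rewrite mulrA.
have -> : a / 2 * (2 / a) = 1 by field; rewrite gt_eqF.
by rewrite mul1r.
Qed.

Lemma for_large_ln_ge1 : for_large (fun X => 1 <= ln X).
Proof.
exists (expR 1) => X eX.
by rewrite -[1](@expRK R) ler_ln ?posrE ?expR_gt0// (lt_le_trans _ eX)// expR_gt0.
Qed.

Lemma ge0_le_exprn (k : nat) a b : 0 <= a -> a <= b -> a ^+ k <= b ^+ k.
Proof. by move=> a0 ab; rewrite lerXn2r ?nnegrE// (le_trans a0). Qed.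

Lemma ge0_le_expr_le (k : nat) a b : (0 < k)%N -> 0 <= b ->
  a ^+ k <= b ^+ k -> a <= b.
Proof.
move=> k0 b0; have [//|ba] := leP a b.
by rewrite ler_pXn2r ?nnegrE ?(le_trans b0) ?(ltW ba)// leNgt ba.
Qed.

End Asymptotics.

(** * Maximal inequality from the even moments *)

Section Increments.
Set Implicit Arguments.
Unset Strict Implicit.
Unset Printing Implicit Defensive.
Context {R : realType} (E : R -> R).
Context (E_lower : forall x y, x <= y -> E x - E y <= y - x).
Implicit Types (x y a b c r s V Z K X : R) (k n p J q : nat).

Notation mu := (@lebesgue_measure R).

Context (eps : R) (eps_gt0 : 0 < eps).

(** Order-of-magnitude form of the even-moment hypothesis at the single order 2p: main term and
    error are merged into one constant and ln(1/d) is enlarged to ln Z. *)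
Definition even_moment_bound p K (X0 : R) := forall Z d : R, X0 <= Z -> delta_range eps Z d ->
  \int[mu]_(x in `[1, Z]) (`|E ((1 + d) * x) - E x| ^+ (2 * p)) <=
    K * Z * (Z * d * ln Z) ^+ p.

(** The chain starts at the smallest admissible ratio r = 1 + Z^(-1+eps), so its mesh is at most Z
    (r - 1) = Z^eps, and ends at the last dyadic level 1 + D not above 1 + d. All levels in between
    are admissible too. *)
Lemma majorant_exists p K (X0 : R) Z (d : R) : (2 <= p)%N -> 0 <= K ->
  even_moment_bound p K X0 -> X0 <= Z -> 1 <= Z -> delta_range eps Z d ->
  exists (D : R) (G : R -> R), [/\ d / 3 < D <= d, lbm G, forall x, 0 <= G x,
    forall a b, 1 <= a -> a <= b -> (1 + D) * b <= Z ->
      \int[mu]_(x in `[a, b]) G x <=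
        chaining_const p * (K * Z * (Z * D * ln Z) ^+ p) &
    forall x y, 0 <= x -> x <= y -> y <= (1 + D) * x -> (1 + D) * x <= Z ->
      `|E y - E x| ^+ (2 * p) <=
        2 ^+ (2 * p) * (G x + (Z `^ eps) ^+ (2 * p))].
Proof.
move=> p2 K0 mom XZ Z1 /andP[dlo dhi]; have Z0 : 0 < Z by rewrite (lt_le_trans _ Z1).
pose r := 1 + Z `^ (-1 + eps); have r1 : 1 < r by rewrite ltrDl powR_gt0.
have rE : r - 1 = Z `^ (-1 + eps) by rewrite /r addrC addKr.
have d1 : d <= 1.
  by apply: (le_trans dhi); rewrite -(powRr0 Z); apply: ler_powR => //; rewrite oppr_le0 ltW.
have [|J /andP[Jlo Jhi]] := @dyadic_ratio_exists R r d r1 _ d1; first by rewrite rE.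
have DJ : 1 + (r ^+ (2 ^ J) - 1) = r ^+ (2 ^ J) by rewrite addrC subrK.
exists (r ^+ (2 ^ J) - 1), (dyadic_majorant E (2 * p) r J); split.
- by rewrite Jlo andbT ltr_pdivrMr// mulrC.
- exact: dyadic_majorant_lbm.
- exact: dyadic_majorant_ge0.
- move=> a b a1 ab; rewrite DJ => bZ.
  have lnZ := ln_ge0 Z1.
  rewrite [Z * _ * _]mulrAC exprMn !mulrA -[_ * K * _]mulrA -[_ * (K * _) * _]mulrA.
  apply: (@Rintegral_dyadic_majorant R E E_lower p r J _ Z) => //; first exact: ltW.
    by rewrite mulr_ge0 ?mulr_ge0 ?exprn_ge0 ?mulr_ge0// ltW.
  move=> j jJ; rewrite -!mulrA -exprMn mulrA [Z * ln Z * _]mulrAC.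
  have := mom Z (r ^+ (2 ^ j) - 1) XZ; rewrite [1 + _]addrC subrK.
  apply.
  apply/andP; split.
    rewrite -rE lerD2r -{1}[r]expr1 ler_weXn2l ?expn_gt0// ltW//.
  apply: le_trans dhi; apply: le_trans Jlo; rewrite lerD2r ler_weXn2l ?leq_exp2l// ltW//.
- move=> x y x0 xy; rewrite DJ => yx xZ.
  have -> : Z `^ eps = Z * (r - 1).
    by rewrite rE -{2}(powRr1 (ltW Z0)) -powRD_gt0// addrA subrr add0r.
  by apply: maximal_increment => //; [rewrite muln_gt0 (leq_trans _ p2)|exact: ltW].
Qed.

(** The maximal function does not see which point [v x] of the window is taken. The scale is Z = 8y
    because (1 + D) rho x <= 2 * 2 * 2y; the ratio 3u/y guarantees D > u/y, so the chain covers
    length u; and Z D <= 8 * 3u explains the 24. *)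
Lemma block_increment p K (X0 : R) y (u rho : R) a b (v : R -> R) : (2 <= p)%N -> 0 <= K ->
  even_moment_bound p K X0 -> X0 <= 8 * y -> 1 <= y ->
  0 < u -> delta_range eps (8 * y) (3 * (u / y)) -> 1 <= rho -> rho <= 2 ->
  y <= a -> a <= b -> b <= 2 * y -> lbm v ->
  (forall x, a <= x -> x <= b -> rho * x <= v x <= rho * x + u) ->
  \int[mu]_(x in `[a, b]) (`|E (v x) - E (rho * x)| ^+ (2 * p)) <=
    2 ^+ (2 * p) * (8 * 24 ^+ p * chaining_const p * K + 1) * y *
    ((u * ln (8 * y)) ^+ p + ((8 * y) `^ eps) ^+ (2 * p)).
Proof.
move=> p2 K0 mom Xy y1 u0 range r1 r2 ya ab by2 bv vP.
have y0 : 0 < y by rewrite (lt_le_trans _ y1).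
have Z1 : 1 <= 8 * y by lra.
have [D [G [/andP[Dlo Dhi] bG G0 IG GP]]] := majorant_exists p2 K0 mom Xy Z1 range.
have D1 : D <= 1.
  case/andP: range => _ dhi; apply: (le_trans Dhi); apply: (le_trans dhi).
  by rewrite -[leRHS](powRr0 (8 * y)); apply: ler_powR => //; rewrite oppr_le0 ltW.
have uy : 0 < u / y by rewrite divr_gt0.
have D0 : 0 < D by apply: lt_trans Dlo; rewrite divr_gt0// mulr_gt0.
have lnZ : 0 <= ln (8 * y) by exact: ln_ge0.
have bE := lower_lipschitz_lbm E_lower.
have top x : a <= x -> x <= b -> (1 + D) * (rho * x) <= 8 * y.
  move=> ax xb; have x0 : 0 <= x by rewrite (le_trans _ ax)// (le_trans _ ya)// ltW.
  have : (1 + D) * (rho * x) <= 2 * (2 * (2 * y)).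
    by rewrite ler_pM ?mulr_ge0 ?ler_pM//; lra.
  lra.
set c2 := 2 ^+ (2 * p); set eK := ((8 * y) `^ eps) ^+ (2 * p).
have c20 : 0 <= c2 by rewrite exprn_ge0.
have eK0 : 0 <= eK by rewrite exprn_ge0 ?powR_ge0.
apply: (@le_trans _ _ (\int[mu]_(x in `[a, b]) (c2 * (G (rho * x) + eK)))).
  apply: le_Rintegral_itv.
  - apply: lbm_exp; apply: lbm_norm; apply: lbm_sub; last exact: lbm_scaled.
    exact: lbm_comp.
  - by apply: lbm_scale; apply: lbm_add; [exact: lbm_scaled|exact: lbm_cst].
  move=> x ax xb; have /andP[vlo vhi] := vP x ax xb.
  have x0 : 0 <= x by rewrite (le_trans _ ax)// (le_trans _ ya)// ltW.
  apply: GP => //; [by rewrite mulr_ge0//; lra| |exact: top].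
  apply: (le_trans vhi); rewrite mulrDl mul1r lerD2l.
  have : u / y * y <= D * (rho * x).
    rewrite ler_pM ?(ltW uy) ?(ltW y0)//; first lra.
    by apply: (le_trans ya); apply: (le_trans ax); rewrite ler_peMl.
  by rewrite divfK// gt_eqF.
rewrite Rintegral_itvZ; last by apply: lbm_add; [exact: lbm_scaled|exact: lbm_cst].
rewrite Rintegral_itvD; [|exact: lbm_scaled|exact: lbm_cst].
rewrite Rintegral_itv_cst// -!mulrA ler_wpM2l//.
have H : \int[mu]_(x in `[a, b]) G (rho * x) <=
    chaining_const p * (K * (8 * y) * (24 * (u * ln (8 * y))) ^+ p).
  apply: (le_trans (ge0_Rintegral_itv_dilate a b bG G0 r1)).
  have C1 := @chaining_const_ge1 R p p2.
  apply: (le_trans (IG _ _ _ _ _)).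
  - by rewrite -[1]mulr1 ler_pM//; lra.
  - by rewrite ler_wpM2l//; lra.
  - by apply: top.
  apply: ler_wpM2l; first lra.
  apply: ler_wpM2l; first by rewrite mulr_ge0//; lra.
  apply: lerXn2r; rewrite ?nnegrE ?mulr_ge0//; try lra.
  rewrite mulrA ler_wpM2r//.
  apply: (@le_trans _ _ (8 * y * (3 * (u / y)))); first by rewrite ler_wpM2l//; lra.
  have -> : 8 * y * (3 * (u / y)) = 24 * u by field; rewrite gt_eqF.
  by [].
rewrite exprMn in H.
set T := (u * ln (8 * y)) ^+ p in H *; set C := chaining_const p in H *.
have T0 : 0 <= T by rewrite exprn_ge0// mulr_ge0// ltW.
have C0 : 0 <= C by rewrite (le_trans _ (chaining_const_ge1 p2)).
set m24 := 24 ^+ p in H *; have m0 : 0 <= m24 by rewrite exprn_ge0.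
have e1 : (b - a) * eK <= y * eK by rewrite ler_wpM2r//; lra.
have q0 : 0 <= 8 * m24 * C * K * y * eK by rewrite !mulr_ge0// ltW.
have q1 : 0 <= y * T by rewrite mulr_ge0// ltW.
lra.
Qed.

End Increments.

(** * Pointwise bounds for increments *)

Section Pointwise.
Set Implicit Arguments.
Unset Strict Implicit.
Unset Printing Implicit Defensive.
Context {R : realType}.
Implicit Types (E : R -> R) (eps x y a b c h r s w V Z K X : R) (k n p J q N : nat).

Notation mu := (@lebesgue_measure R).

(* The majorant of an increment based at [x] controls [E y - E w] for every [x]
   slightly below [w]; averaging over such [x] turns the mean bound into a
   pointwise one, at the cost of a factor [Z `^ (eps / p)]. *)
Lemma short_increment E eps p K (X0 tau : R) :
  (forall x y, x <= y -> E x - E y <= y - x) -> 0 < eps -> eps <= 1 / 3 -> (2 <= p)%N -> 0 <= K ->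
  even_moment_bound E eps p K X0 -> 0 < tau -> eps <= p%:R * tau ->
  exists2 W : R, 1 <= W & forall w y, W <= w -> w <= y ->
    y <= w + w * (4 * w) `^ (- eps) / 12 ->
    `|E y - E w| <= (4 * w) `^ ((1 - eps) / 2 + tau).
Proof.
move=> E_lower e_gt0 e_le p2 K0 mom tau0 eps_tau; have p0 : (0 < p)%N by rewrite (leq_trans _ p2).
have pR0 : 0 < p%:R :> R by rewrite ltr0n.
set C := @chaining_const R p; have C0 : 0 <= C by rewrite (le_trans _ (chaining_const_ge1 p2)).
set c2 := 2 ^+ (2 * p) : R; have c20 : 0 <= c2 by rewrite exprn_ge0.
pose c3 := 2 * c2 * c2 * (48 * C * K + 1).
have [||M evM] := for_large_and (@for_large_powR_ge R c3 (p%:R * tau / 2) _)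
   (@for_large_ln_le R (tau / 2) _); rewrite ?divr_gt0 ?mulr_gt0//.
exists (2 + `|X0| + `|M|) => [|w y]; first by have := normr_ge0 X0; have := normr_ge0 M; lra.
move=> Ww wy; have := ler_norm X0; have := ler_norm M => M_le X0_le.
have w2 : 2 <= w by have := normr_ge0 X0; have := normr_ge0 M; lra.
set Z := 4 * w; have Z1 : 1 <= Z by rewrite /Z; lra.
have Z0 : 0 < Z by exact: lt_le_trans Z1.
have XZ : X0 <= Z by rewrite /Z; have := normr_ge0 M; lra.
have [c3Z lnZ] : c3 <= Z `^ (p%:R * tau / 2) /\ ln Z <= Z `^ (tau / 2).
  by apply: evM; rewrite /Z; have := normr_ge0 X0; lra.
have L0 : 0 <= ln Z by exact: ln_ge0.
set d := Z `^ (- eps) => yd; have d0 : 0 < d by exact: powR_gt0.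
have d1 : d <= 1.
  by rewrite -[leRHS](powRr0 Z); apply: ler_powR => //; rewrite oppr_le0 ltW.
have range : delta_range eps Z d.
  by rewrite /delta_range lexx andbT; apply: ler_powR => //; lra.
have [D [G [/andP[Dlo Dhi] bG G0 IG GP]]] := majorant_exists E_lower e_gt0 p2 K0 mom XZ Z1 range.
have D0 : 0 < D by clear - d0 Dlo; lra.
set e := (Z `^ eps) ^+ (2 * p) in GP.
have e0 : 0 <= e by rewrite exprn_ge0 ?powR_ge0.
(* Averaging window of length w D / 4. From each of its points the chain still reaches y: on the one
   hand y <= w + w d / 12 with d < 3D, on the other (1 + D) x >= w + w D / 2. *)
set a := w - w * D / 4; have w0 : 0 < w by exact: lt_le_trans w2.
have wD0 : 0 < w * D by exact: mulr_gt0.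
have wDw : w * D <= w by rewrite ler_piMr ?(ltW w0)// (le_trans Dhi).
have a1 : 1 <= a by rewrite /a; clear - w2 wDw; lra.
have aw : a <= w by rewrite /a; clear - wD0; lra.
have top x : x <= w -> (1 + D) * x <= Z.
  move=> xw; have D1 : 0 <= 1 + D by rewrite addr_ge0// ltW.
  by have := ler_wpM2l D1 xw; rewrite /Z; clear - wDw w0; lra.
set c := `|E y - E w| ^+ (2 * p).
have cG x : a <= x -> x <= w -> c <= 2 * c2 * c2 * (G x + e).
  move=> ax xw; have x0 : 0 <= x by clear - a1 ax; lra.
  have yx : y <= (1 + D) * x.
    have d3 : d <= 3 * D by clear - Dlo; lra.
    have D1 : 0 <= 1 + D by rewrite addr_ge0// ltW.
    have := ler_wpM2l (ltW w0) d3; have := ler_wpM2l D1 ax.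
    have := ler_wpM2l (ltW wD0) (le_trans Dhi d1).
    by move: yd wD0; rewrite /a; clear; lra.
  have H1 := GP x y x0 (le_trans xw wy) yx (top _ xw).
  have H2 := GP x w x0 xw (le_trans wy yx) (top _ xw).
  apply: (@le_trans _ _ ((`|E y - E x| + `|E w - E x|) ^+ (2 * p))).
    rewrite lerXn2r ?nnegrE ?addr_ge0//.
    by rewrite -[E w - E x]opprB normrN (le_trans _ (ler_normD _ _))// addrA subrK.
  apply: (le_trans (exprD_le _ (normr_ge0 _) (normr_ge0 _))); rewrite -/c2.
  by have := ler_wpM2l c20 (lerD H1 H2); rewrite -/c2; clear; lra.
pose T := (Z `^ (1 - eps) * ln Z) ^+ p.
have T0 : 0 <= T by rewrite exprn_ge0// mulr_ge0 ?powR_ge0.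
have mean : (w - a) * c <= 2 * c2 * c2 * (\int[mu]_(x in `[a, w]) G x + (w - a) * e).
  rewrite -(Rintegral_itv_cst e aw) -Rintegral_itvD//; last exact: lbm_cst.
  rewrite -Rintegral_itvZ; last by apply: lbm_add => //; exact: lbm_cst.
  rewrite -(Rintegral_itv_cst c aw); apply: le_Rintegral_itv => //.
    exact: lbm_cst.
  by apply: lbm_scale; apply: lbm_add => //; exact: lbm_cst.
have int_le : \int[mu]_(x in `[a, w]) G x <= (w - a) * (48 * C * K * (Z `^ eps * T)).
  apply: (le_trans (IG a w a1 aw (top _ (lexx w)))); rewrite -/C.
  have TD : (Z * D * ln Z) ^+ p <= T.
    apply: lerXn2r; rewrite ?nnegrE; [|by rewrite mulr_ge0 ?powR_ge0|].
      by apply: mulr_ge0 => //; apply: mulr_ge0; exact: ltW.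
    rewrite ler_wpM2r// powRD_gt0// powRr1; last exact: ltW.
    by apply: ler_wpM2l => //; exact: ltW.
  (* Dividing by the window length costs a factor of order 1/D, which is below 3 Z^eps. *)
  have Ze : 1 <= 3 * D * Z `^ eps.
    have d3 : d <= 3 * D by clear - Dlo; lra.
    have := ler_wpM2r (powR_ge0 Z eps) d3.
    by rewrite -powRD_gt0// addNr powRr0.
  apply: (@le_trans _ _ (C * (K * Z * T))).
    by apply: ler_wpM2l => //; apply: ler_wpM2l => //; exact: (mulr_ge0 K0 (ltW Z0)).
  have : C * (K * Z * T) * 1 <= C * (K * Z * T) * (3 * D * Z `^ eps).
    by apply: ler_wpM2l => //; exact: (mulr_ge0 C0 (mulr_ge0 (mulr_ge0 K0 (ltW Z0)) T0)).
  by rewrite /a /Z; clear; lra.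
have c_le : c <= 2 * c2 * c2 * (48 * C * K * (Z `^ eps * T) + e).
  have wa0 : 0 < w - a by rewrite /a; clear - wD0; lra.
  rewrite -(ler_pM2l wa0); apply: (le_trans mean).
  have := ler_wpM2l (mulr_ge0 (mulr_ge0 (ler0n R 2) c20) c20) (lerD int_le (lexx ((w - a) * e))).
  by clear; lra.
have pk : (2 * p)%:R = 2 * p%:R :> R by rewrite natrM.
apply: (@ge0_le_expr_le R (2 * p)); rewrite ?muln_gt0 ?powR_ge0// -/c powR_exprn pk.
(* Of the available exponent 2 p tau, the averaging loss Z^eps takes p tau and the logarithm p tau /
   2; the last p tau / 2 absorbs [c3]. The mesh error Z^(2 p eps) fits below Z^(p (1 - eps)) because
   eps <= 1/3. *)
pose q := p%:R * (1 - eps) + 3 / 2 * (p%:R * tau).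
have pe : p%:R * (3 * eps) <= p%:R * 1 by apply: ler_wpM2l; [exact: ltW|clear - e_le; lra].
have pt : 0 < p%:R * tau by rewrite mulr_gt0.
have ZT : Z `^ eps * T <= Z `^ q.
  have -> : q = p%:R * tau + (1 - eps + tau / 2) * p%:R by rewrite /q; field.
  rewrite powRD_gt0//; apply: ler_pM; rewrite ?powR_ge0//; first exact: ler_powR.
  rewrite -powR_exprn; apply: ge0_le_exprn; first by rewrite mulr_ge0 ?powR_ge0.
  by rewrite [leRHS]powRD_gt0//; apply: ler_wpM2l; rewrite ?powR_ge0.
have eZ : e <= Z `^ q.
  rewrite /e powR_exprn pk; apply: ler_powR => //; rewrite /q; clear - pe pt; lra.
have Zq0 : 0 <= Z `^ q by exact: powR_ge0.
apply: (le_trans c_le); apply: (@le_trans _ _ (c3 * Z `^ q)).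
  have CK0 : 0 <= 48 * C * K by rewrite !mulr_ge0.
  have := lerD (ler_wpM2l CK0 ZT) eZ.
  move/(ler_wpM2l (mulr_ge0 (mulr_ge0 (ler0n R 2) c20) c20)) => H.
  by apply: (le_trans H); rewrite /c3; clear; lra.
apply: (le_trans (ler_wpM2r Zq0 c3Z)); rewrite -powRD_gt0//.
by apply: ler_powR => //; rewrite /q; clear; lra.
Qed.

Lemma increment_steps E B s x (M : R) N y :
  (forall w y, x <= w -> w <= y -> y <= w + s -> y <= M -> `|E y - E w| <= B) ->
  0 <= s -> 0 <= B -> x <= y -> y <= x + N%:R * s -> y <= M ->
  `|E y - E x| <= N%:R * B.
Proof.
move=> stepB s0 B0; elim: N y => [|N IH] y xy.
  rewrite mul0r addr0 => yx _; have -> : y = x by apply/eqP; rewrite eq_le yx xy.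
  by rewrite subrr normr0 mul0r.
rewrite -natr1 => yN yM; set w := x + N%:R * s.
have xw : x <= w by rewrite lerDl mulr_ge0.
rewrite mulrDl mul1r; have [yw|wy] := leP y w.
  by apply: (le_trans (IH y xy yw yM)); rewrite lerDl.
rewrite -[E y](subrK (E w)) -addrA [leRHS]addrC (le_trans (ler_normD _ _))//.
apply: lerD; last by apply: IH => //; rewrite (le_trans (ltW wy)).
by apply: stepB; rewrite ?(ltW wy)//; rewrite /w; lra.
Qed.

(** Walk from x to x + h in steps of x^(1-eps) / 48, short enough for [short_increment] because w
    (4w)^(-eps) / 12 = (4w)^(1-eps) / 48. The number of steps, at most 48 h x^(-(1-eps)) + 1, times
    the bound (8x)^th per step produces the two terms. *)
Lemma long_increment E eps p K (X0 tau : R) :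
  (forall x y, x <= y -> E x - E y <= y - x) -> 0 < eps -> eps <= 1 / 3 -> (2 <= p)%N -> 0 <= K ->
  even_moment_bound E eps p K X0 -> 0 < tau -> tau <= 1 / 2 -> eps <= p%:R * tau ->
  exists2 W : R, 1 <= W & forall x h, W <= x -> 0 <= h -> h <= x ->
    `|E (x + h) - E x| <= 20 * 20 * (h * x `^ (- ((1 - eps) / 2) + tau) +
                                 x `^ ((1 - eps) / 2 + tau)).
Proof.
move=> E_lower e_gt0 e_le p2 K0 mom tau0 tau1 eps_tau.
have [W W1 HW] := short_increment E_lower e_gt0 e_le p2 K0 mom tau0 eps_tau.
exists W => // x h Wx h0 hx; have x1 := le_trans W1 Wx.
have x0 : 0 < x by exact: lt_le_trans x1.
set th := (1 - eps) / 2 + tau; have th0 : 0 <= th by rewrite /th; lra.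
have th1 : th <= 1 by rewrite /th; lra.
pose s := x `^ (1 - eps) / 48; have s0 : 0 < s by rewrite divr_gt0// powR_gt0.
pose N := (Num.truncn (h / s)).+1.
have hs : 0 <= h / s by rewrite divr_ge0// ltW.
have NE : N%:R <= h / s + 1 :> R by rewrite -natr1 lerD2r truncn_le.
have hN : h <= N%:R * s by rewrite -ler_pdivrMr// ltW// truncnS_gt.
have B0 : 0 <= 8 * x `^ th by rewrite mulr_ge0 ?powR_ge0.
have := @increment_steps E (8 * x `^ th) s x (2 * x) N (x + h) _ (ltW s0) B0.
have xh : x <= x + h by rewrite lerDl.
have xhN : x + h <= x + N%:R * s by rewrite lerD2l.
move=> /(_ _ xh xhN) H; apply: (le_trans (H _ _)).
- move=> w y xw wy ys y2x; apply: (@le_trans _ _ ((4 * w) `^ th)).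
    apply: HW => //; first exact: le_trans xw.
    apply: (le_trans ys); rewrite lerD2l /s.
    have w4 : 0 < 4 * w by rewrite mulr_gt0// (lt_le_trans x0).
    have : x `^ (1 - eps) <= (4 * w) `^ (1 - eps).
      by apply: powR_le; [exact: ltW|lra|lra].
    rewrite [(4 * w) `^ (1 - eps)]powRD_gt0// powRr1 ?(ltW w4)//; lra.
  apply: (@le_trans _ _ ((8 * x) `^ th)); last by apply: powR_cst_le => //; lra.
  by apply: powR_le => //; lra.
- by rewrite mulr2n mulrDl mul1r lerD2l.
apply: (le_trans (ler_wpM2r B0 NE)).
have -> : h / s = 48 * (h * x `^ (- (1 - eps))).
  by rewrite /s powRN; field; rewrite gt_eqF// powR_gt0.
have : x `^ (- (1 - eps)) * x `^ th = x `^ (- ((1 - eps) / 2) + tau).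
  by rewrite -powRD_gt0//; congr (_ `^ _); rewrite /th; field.
have : 0 <= h * x `^ (- ((1 - eps) / 2) + tau) by rewrite mulr_ge0 ?powR_ge0.
move=> H1 H2; rewrite -H2 in H1 *.
have := powR_ge0 x th; lra.
Qed.

End Pointwise.

(** * Growth of E, and increments at small x *)

Section Growth.
Set Implicit Arguments.
Unset Strict Implicit.
Unset Printing Implicit Defensive.
Context {R : realType}.
Implicit Types (E : R -> R) (eps x y a b c h r s w V Z K X : R) (k n p J q N : nat).

Notation mu := (@lebesgue_measure R).

(** Doubling: [long_increment] with h = x = v bounds E(2v) - E(v) by 800 v^be. The induction closes
    because 2^be >= sqrt 2 >= 7/5 and 2000 * (7/5 - 1) = 800; [A] covers the initial interval. *)
Lemma error_growth E eps p K (X0 tau : R) :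
  (forall x y, x <= y -> E x - E y <= y - x) -> 0 < eps -> eps <= 1 / 3 -> (2 <= p)%N -> 0 <= K ->
  even_moment_bound E eps p K X0 -> 0 < tau -> tau <= 1 / 2 -> eps <= p%:R * tau ->
  exists2 B : R, 0 <= B & forall w, 1 <= w -> `|E w| <= B * w `^ ((1 + eps) / 2 + tau).
Proof.
move=> E_lower e_gt0 e_le p2 K0 mom tau0 tau1 eps_tau.
have [W W1 HW] := long_increment E_lower e_gt0 e_le p2 K0 mom tau0 tau1 eps_tau.
set be := (1 + eps) / 2 + tau; have be_half : 1 / 2 <= be by rewrite /be; lra.
have [_ /(_ (2 * W))[A EA]] := lower_lipschitz_lbm E_lower.
have A0 : 0 <= A by apply: le_trans (EA 0 _); rewrite ?normr_ge0// normr0; lra.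
exists (A + 40 * 50); first by lra.
suff H N w : 1 <= w -> w <= 2 * W * 2 ^+ N -> `|E w| <= (A + 40 * 50) * w `^ be.
  move=> w w1; apply: (H (Num.bound w)) => //.
  have w0 : 0 <= w by lra.
  apply: (le_trans (ltW (archi_boundP w0))).
  apply: (@le_trans _ _ (2 ^+ Num.bound w)).
    by rewrite -natrX ler_nat ltnW// ltn_expl.
  by rewrite ler_peMl ?exprn_ge0//; lra.
elim: N w => [|N IH] w w1.
  rewrite expr0 mulr1 => wW; apply: (@le_trans _ _ A).
    by apply: EA; rewrite ger0_norm//; lra.
  have : (A + 40 * 50) * 1 <= (A + 40 * 50) * w `^ be.
    by rewrite ler_wpM2l ?powR_ge1//; lra.
  lra.
have [wN _|Nw wN1] := leP w (2 * W * 2 ^+ N); first exact: IH.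
have N1 : 1 <= (2 : R) ^+ N by rewrite exprn_ege1//; lra.
have W2 : 2 * W * 1 <= 2 * W * 2 ^+ N by rewrite ler_wpM2l//; lra.
set v := w / 2; have v1 : 1 <= v by rewrite /v; lra.
have v0 : 0 < v by lra.
have wE : w = v + v by rewrite /v -splitr.
have := IH v v1; rewrite exprS in wN1.
have -> : v <= 2 * W * 2 ^+ N by rewrite /v; lra.
move=> /(_ isT) Ev.
have := HW v v; rewrite -wE lexx (ltW v0) => /(_ _ isT isT).
have -> : W <= v by rewrite /v; lra.
move=> /(_ isT) Ewv.
have e1 : v * v `^ (- ((1 - eps) / 2) + tau) = v `^ be.
  by rewrite -{1}(powRr1 (ltW v0)) -powRD_gt0//; congr (_ `^ _); rewrite /be; field.
have e2 : v `^ ((1 - eps) / 2 + tau) <= v `^ be by apply: ler_powR => //; rewrite /be; lra.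
have vb0 := powR_ge0 v be.
have w_ge : 7 / 5 * v `^ be <= w `^ be.
  have -> : w = 2 * v by rewrite wE; ring.
  rewrite powRM ?(ltW v0)//; apply: ler_wpM2r => //.
  apply: (@le_trans _ _ (2 `^ (1 / 2))); last by apply: ler_powR => //; lra.
  have c0 : (0 : R) <= 7 / 5 by rewrite divr_ge0.
  rewrite div1r powR12_sqrt// -[leLHS](ger0_norm c0) -sqrtr_sqr.
  by apply: ler_wsqrtr; rewrite expr2; lra.
have := ler_normD (E w - E v) (E v); rewrite subrK => tri.
have : (A + 40 * 50) * (7 / 5 * v `^ be) <= (A + 40 * 50) * w `^ be by rewrite ler_wpM2l//; lra.
have : 0 <= A * v `^ be by rewrite mulr_ge0.
lra.
Qed.

(** For x <= h both values of [E] are bounded by [error_growth]. For x > h, apart from x^tau, the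
    first term of [long_increment] is worst at x = h, where it is h^((1+eps)/2), and the second at
    the largest x, where it is about h^(1/2). Since x <= M h^2, the factor x^tau becomes h^(2
    tau). *)
Lemma pointwise_increment E eps p K (X0 tau M : R) :
  (forall x y, x <= y -> E x - E y <= y - x) -> 0 < eps -> eps <= 1 / 3 -> (2 <= p)%N -> 0 <= K ->
  even_moment_bound E eps p K X0 -> 0 < tau -> tau <= 1 / 2 -> eps <= p%:R * tau ->
  1 <= M ->
  exists B H : R, forall x h, H <= h -> 1 <= x -> x <= M * h `^ (1 - eps)^-1 ->
    `|E (x + h) - E x| <= B * h `^ ((1 + eps) / 2 + 2 * tau).
Proof.
move=> E_lower e_gt0 e_le p2 K0 mom tau0 tau1 eps_tau M1.
have [W W1 HW] := long_increment E_lower e_gt0 e_le p2 K0 mom tau0 tau1 eps_tau.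
have [B B0 EB] := error_growth E_lower e_gt0 e_le p2 K0 mom tau0 tau1 eps_tau.
set be := (1 + eps) / 2 + tau in EB; set be2 := (1 + eps) / 2 + 2 * tau.
exists (6 * B + 20 * 40 * (M * M)), W => x h Wh x1 xM.
have h1 := le_trans W1 Wh; have h0 : 0 < h by lra.
have MM : 1 <= M * M by rewrite -[1]mulr1 ler_pM.
have hb0 := powR_ge0 h be2.
have [xh|hx] := leP x h.
  have hb : h `^ be <= h `^ be2 by apply: ler_powR => //; rewrite /be /be2; lra.
  have Ex : `|E x| <= B * h `^ be2.
    apply: (le_trans (EB x x1)); rewrite ler_wpM2l//; apply: le_trans hb.
    by apply: powR_le => //; rewrite /be; lra.
  have Exh : `|E (x + h)| <= B * (4 * h `^ be2).
    have xh1 : 1 <= x + h by lra.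
    apply: (le_trans (EB _ xh1)); rewrite ler_wpM2l//.
    apply: (@le_trans _ _ ((2 * h) `^ be)).
      by apply: powR_le => //; rewrite /be; lra.
    rewrite powRM//; last exact: ltW.
    apply: ler_pM => //; rewrite ?powR_ge0//.
    apply: (@le_trans _ _ (2 `^ 2%:R)); first by apply: ler_powR; rewrite ?ler1n// /be; lra.
    by rewrite powR_mulrn// expr2; lra.
  have := ler_normB (E (x + h)) (E x).
  have : 0 <= B * h `^ be2 by rewrite mulr_ge0.
  have : 0 <= M * M * h `^ be2 by rewrite mulr_ge0//; lra.
  lra.
have x0 : 0 < x by lra.
apply: (le_trans (HW x h _ _ _)); try lra.
have xh2 : x <= M * h `^ 2.
  apply: (le_trans xM); rewrite ler_wpM2l//; first lra.
  apply: ler_powR => //; rewrite -[2]invrK lef_pV2 ?posrE ?invr_gt0//; lra.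
have xt : x `^ tau <= M * h `^ (2 * tau).
  rewrite powRrM; apply: (@le_trans _ _ ((M * h `^ 2) `^ tau)).
    by apply: powR_le => //; lra.
  by apply: powR_cst_le => //; rewrite ?powR_ge0//; lra.
have t1 : h * x `^ (- ((1 - eps) / 2) + tau) <= M * h `^ be2.
  have -> : h `^ be2 = h * h `^ (- ((1 - eps) / 2)) * h `^ (2 * tau).
    by rewrite -{2}(powRr1 (ltW h0)) -!powRD_gt0//; congr (_ `^ _); rewrite /be2; field.
  rewrite powRD_gt0// mulrA mulrCA; apply: ler_pM => //; rewrite ?mulr_ge0 ?powR_ge0 ?(ltW h0)//.
  by rewrite ler_wpM2l ?(ltW h0)//; apply: powR_le_neg => //; [exact: ltW|lra].
have t2 : x `^ ((1 - eps) / 2 + tau) <= M * M * h `^ be2.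
  have -> : h `^ be2 = h `^ ((1 + eps) / 2) * h `^ (2 * tau) by rewrite -powRD_gt0.
  rewrite powRD_gt0// mulrACA; apply: ler_pM => //; rewrite ?powR_ge0//.
  apply: (@le_trans _ _ ((M * h `^ (1 - eps)^-1) `^ ((1 - eps) / 2))).
    by apply: powR_le => //; lra.
  apply: (le_trans (powR_cst_le _ _ _ _)) => //; rewrite ?powR_ge0//; try lra.
  rewrite ler_wpM2l//; first lra.
  rewrite -powRrM; apply: ler_powR => //.
  by rewrite mulrA mulVf ?gt_eqF//; lra.
have : M * h `^ be2 <= M * M * h `^ be2.
  by rewrite ler_wpM2r// ler_peMl//; lra.
have : 0 <= B * h `^ be2 by rewrite mulr_ge0.
lra.
Qed.

End Growth.

(** * Perturbation of powers and summation over geometric blocks *)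

Section Comparison.
Set Implicit Arguments.
Unset Strict Implicit.
Unset Printing Implicit Defensive.
Context {R : realType}.
Implicit Types (a b d x y : R) (n k N : nat).

Lemma exprn_diff_le n a b (M : R) : 1 <= M -> `|a| <= M -> `|b| <= M ->
  `|a ^+ n - b ^+ n| <= n%:R * `|a - b| * M ^+ n.
Proof.
move=> M1 aM bM; have M0 : 0 <= M by lra.
elim: n => [|n IH]; first by rewrite subrr normr0 !mul0r.
have -> : a ^+ n.+1 - b ^+ n.+1 = a * (a ^+ n - b ^+ n) + (a - b) * b ^+ n.
  by rewrite !exprS; ring.
apply: (le_trans (ler_normD _ _)); rewrite !normrM.
have h1 : `|a| * `|a ^+ n - b ^+ n| <= M * (n%:R * `|a - b| * M ^+ n) by rewrite ler_pM.
have h2 : `|a - b| * `|b ^+ n| <= `|a - b| * (M ^+ n * M).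
  apply: ler_wpM2l => //; apply: (@le_trans _ _ (M ^+ n)).
    by rewrite normrX; apply: ge0_le_exprn.
  by rewrite ler_peMr ?exprn_ge0.
rewrite -natr1 exprS; lra.
Qed.

(** Let d = |b - a| and m = max(1, |a|). If d <= ka m, then |a| and |b| are at most 2m, the
    difference is at most n d (2m)^n, and the choice of [ka] makes this at most eta m^k. Otherwise
    both are at most 2d/ka, a number >= 1, and both powers are absorbed into d^k. *)
Lemma exprn_perturb n k (eta : R) : (n < k)%N -> 0 < eta ->
  exists2 C : R, 0 <= C & forall a b,
    `|a ^+ n - b ^+ n| <= eta * (1 + `|a| ^+ k) + C * `|b - a| ^+ k.
Proof.
move=> nk eta0; pose q := n%:R * 2 ^+ n + 1 : R.
have q1 : 1 <= q by rewrite /q lerDr mulr_ge0 ?exprn_ge0.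
pose ka := Num.min 1 (eta / q); have q0 : 0 < q by lra.
have ka0 : 0 < ka by rewrite lt_min ltr01 divr_gt0.
have ka1 : ka <= 1 by rewrite ge_min lexx.
have kaeta : ka * q <= eta by rewrite -ler_pdivlMr// ge_min lexx orbT.
exists (2 * (2 / ka) ^+ k); first by rewrite mulr_ge0 ?exprn_ge0 ?divr_ge0// ltW.
move=> a b; set d := `|b - a|; have d0 : 0 <= d by exact: normr_ge0.
pose m := Num.max 1 `|a|; have m1 : 1 <= m by rewrite le_max lexx.
have am : `|a| <= m by rewrite le_max lexx orbT.
have bm : `|b| <= m + d by rewrite -[b](subrK a) addrC (le_trans (ler_normD _ _))// lerD.
have mk : m ^+ k <= 1 + `|a| ^+ k.
  have [a1|a1] := leP 1 `|a|; first by rewrite /m max_r// lerDr.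
  by rewrite /m max_l ?(ltW a1)// expr1n lerDl exprn_ge0.
have m0 : 0 <= m by lra.
have [dm|md] := leP d (ka * m).
  have d_m : d <= m by apply: (le_trans dm); rewrite ler_piMl.
  have := @exprn_diff_le n a b (2 * m); rewrite [`|a - b|]distrC -/d => /(_ _ _ _)/le_trans; apply; try lra.
  apply: (@le_trans _ _ (eta * (1 + `|a| ^+ k))); last first.
    by rewrite lerDl !mulr_ge0 ?exprn_ge0 ?divr_ge0// ltW.
  apply: (@le_trans _ _ (eta * m ^+ k)); last by rewrite ler_wpM2l// ltW.
  apply: (@le_trans _ _ (eta * m ^+ n.+1)); last first.
    by rewrite ler_wpM2l ?(ltW eta0)// ler_weXn2l.
  rewrite exprMn exprS; have mn0 : 0 <= m * m ^+ n by rewrite mulr_ge0 ?exprn_ge0.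
  have : d * (n%:R * 2 ^+ n * m ^+ n) <= ka * m * (n%:R * 2 ^+ n * m ^+ n).
    by rewrite ler_wpM2r// !mulr_ge0 ?exprn_ge0.
  have : ka * (m * m ^+ n) * (n%:R * 2 ^+ n) <= eta * (m * m ^+ n).
    rewrite -mulrA [_ * (n%:R * _)]mulrC mulrA; apply: ler_wpM2r => //.
    apply: le_trans kaeta; apply: ler_wpM2l; first exact: ltW.
    by rewrite /q lerDl.
  lra.
have t1 : 1 <= 2 * d / ka.
  rewrite ler_pdivlMr// mul1r; have : ka * 1 <= ka * m by rewrite ler_wpM2l// ltW.
  lra.
have am' : `|a| <= 2 * d / ka.
  apply: (le_trans am); rewrite ler_pdivlMr// mulrC; lra.
have bm' : `|b| <= 2 * d / ka.
  apply: (le_trans bm); rewrite ler_pdivlMr//.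
  have : d * ka <= d * 1 by rewrite ler_wpM2l.
  lra.
have ek (z : R) : `|z| <= 2 * d / ka -> `|z ^+ n| <= (2 * d / ka) ^+ k.
  move=> zd; rewrite normrX; apply: (@le_trans _ _ ((2 * d / ka) ^+ n)).
    exact: ge0_le_exprn.
  by rewrite ler_weXn2l// ltnW.
apply: (le_trans (ler_normB _ _)).
have := ek _ am'; have := ek _ bm'.
have -> : 2 * d / ka = 2 / ka * d by rewrite mulrAC.
rewrite exprMn; have : 0 <= eta * (1 + `|a| ^+ k) by rewrite mulr_ge0 ?addr_ge0 ?exprn_ge0// ltW.
lra.
Qed.

Lemma exprn_perturb_scaled n k (eta : R) : (n < k)%N -> 0 < eta ->
  exists2 C : R, 0 <= C & forall T a b, 0 < T ->
    `|a ^+ n - b ^+ n| <=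
      T ^+ n * (eta * (1 + `|a| ^+ k / T ^+ k) + C * (`|b - a| ^+ k / T ^+ k)).
Proof.
move=> nk eta0; have [C C0 HC] := exprn_perturb nk eta0; exists C => // T a b T0.
have T_neq0 : T != 0 by rewrite gt_eqF.
have := HC (a / T) (b / T); rewrite -mulrBl !normrM normfV (gtr0_norm T0).
rewrite !exprMn !exprVn -mulrBl normrM normfV.
rewrite (ger0_norm (exprn_ge0 _ (ltW T0))) => H.
by rewrite mulrC -ler_pdivrMr ?exprn_gt0.
Qed.

(** Divide b by r until it falls into [a, r a]; both sides telescope. Writing block bounds as
    increments of [G] avoids indexed sums over blocks. *)
Lemma geometric_descent (r a : R) (F G : R -> R) b : 1 < r -> 0 < a -> a <= b ->
  (forall y, a <= y -> r * y <= b -> `|F (r * y) - F y| <= G (r * y) - G y) ->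
  exists y, [/\ a <= y, y <= r * a, y <= b & `|F b - F y| <= G b - G y].
Proof.
move=> r1 a0 ab step; have r0 : 0 < r by lra.
have [N bN] : exists N, b <= r ^+ N * a.
  exists (Num.bound (b / a / (r - 1))).
  have r10 : 0 < r - 1 by lra.
  have q0 : 0 <= b / a / (r - 1) by rewrite !divr_ge0//; lra.
  rewrite -ler_pdivrMr//; have := archi_boundP q0; rewrite ltr_pdivrMr// => /ltW.
  move=> /le_trans; apply.
  elim: (Num.bound _) => [|j IH]; first by rewrite mul0r expr0.
  rewrite -natr1 exprS mulrDl mul1r.
  have : 1 <= r ^+ j by rewrite exprn_ege1// ltW.
  move=> rj; have : (r - 1) * 1 <= (r - 1) * r ^+ j by rewrite ler_wpM2l// ltW.
  lra.
elim: N b ab bN step => [|N IH] b ab bN step.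
  exists b; split => //; last by rewrite !subrr normr0.
  by apply: (le_trans bN); rewrite expr0 ler_wpM2r//; lra.
have [bra|rab] := leP b (r * a); first by exists b; split; rewrite ?subrr ?normr0.
have bE : r * (b / r) = b by rewrite mulrC divfK// gt_eqF.
have ab' : a <= b / r by rewrite ler_pdivlMr// mulrC ltW.
have bb' : b / r <= b by rewrite ler_pdivrMr// ler_peMr ?ltW//; lra.
have bN' : b / r <= r ^+ N * a by rewrite ler_pdivrMr// mulrAC -exprSr.
have [y ay ryb|y [ay yra yb Fy]] := IH _ ab' bN'.
  by apply: step => //; exact: le_trans bb'.
exists y; split => //; first exact: le_trans bb'.
have := step (b / r) ab'; rewrite bE lexx => /(_ isT) => H.
rewrite -[F b](subrK (F (b / r))) -addrA (le_trans (ler_normD _ _))//; lra.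
Qed.

End Comparison.

(** * Fixed-length increments against fixed-ratio increments *)

Section FixedIncrement.
Set Implicit Arguments.
Unset Strict Implicit.
Unset Printing Implicit Defensive.
Context {R : realType}.
Implicit Types (E : R -> R) (eps x y a b c h r s w V Z K X T : R) (k n p N : nat).

Notation mu := (@lebesgue_measure R).

Lemma shift_lbm E h : (forall x y, x <= y -> E x - E y <= y - x) ->
  lbm (fun x => E (x + h)).
Proof.
move=> E_lower.
have bE := lower_lipschitz_lbm E_lower.
by apply: (@lbm_comp R E) => //; apply: lbm_add; [exact: lbm_id|exact: lbm_cst].
Qed.

(** [C] is chosen before [c], so c^p is a genuine gain. The ratio 3ch/y at scale 8y stays below
    (8y)^(-eps) thanks to 24h <= y^(1-eps), with 24 = 3 * 8. The lower bound on h makes the squared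
    mesh (8y)^(2 eps) at most c h once X is large in terms of c. *)
Lemma fixed_block E eps p K (X0 e1 : R) :
  (forall x y, x <= y -> E x - E y <= y - x) -> 0 < eps -> eps <= 1 / 3 -> (2 <= p)%N -> 0 <= K ->
  even_moment_bound E eps p K X0 -> 0 < e1 ->
  exists2 C : R, 0 < C & forall c, 0 < c -> c <= 1 ->
  for_large (fun X => forall h y rho a b,
    X `^ (2 * eps + e1) <= h -> 24 * h <= y `^ (1 - eps) -> 1 <= y -> y <= X ->
    1 <= rho -> rho <= 2 -> y <= a -> a <= b -> b <= 2 * y ->
    (forall x, a <= x -> x <= b -> rho * x <= x + h <= rho * x + c * h) ->
    \int[mu]_(x in `[a, b]) (`|E (x + h) - E (rho * x)| ^+ (2 * p)) <=
      C * c ^+ p * y * Num.sqrt (h * ln X) ^+ (2 * p)).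
Proof.
move=> E_lower e_gt0 e_le p2 K0 mom e10.
set C2 := 2 ^+ (2 * p) * (8 * 24 ^+ p * chaining_const p * K + 1).
have C20 : 0 < C2.
  rewrite mulr_gt0 ?exprn_gt0// ltr_wpDl// !mulr_ge0 ?exprn_ge0//.
  by rewrite (le_trans _ (chaining_const_ge1 p2)).
exists (C2 * (2 ^+ p + 1)); first by rewrite mulr_gt0// ltr_wpDl ?exprn_ge0.
move=> c c0 c1.
have lt1 : 2 * eps < 2 * eps + e1 by lra.
have lt0 : 0 < 2 * eps + e1 by lra.
have [M HM] := for_large_and (for_large_and (for_large_powR_le (64 / c) lt1)
  (for_large_powR_ge (8 + `|X0|) lt0)) (for_large_and (@for_large_ln_ge1 R) (for_large_ge 8)).
exists M => X /HM[[pX X0X] [lnX X8]] h y rho a b Xh hy y1 yX r1 r2 ya ab by2 vP.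
have X0' : 0 < X by lra.
have y0 : 0 < y by lra.
have h0 : 8 + `|X0| <= h by exact: le_trans Xh.
have hpos : 0 < h by have := normr_ge0 X0; clear - h0; lra.
have yeps : y `^ (1 - eps) <= y by apply: ler1_powR => //; clear - e_gt0; lra.
have Xy : X0 <= 8 * y.
  have := ler_norm X0; have := normr_ge0 X0; clear - h0 hpos hy yeps; lra.
have u0 : 0 < c * h by rewrite mulr_gt0.
have e2 : (8 * X) `^ (2 * eps) <= c * h.
  apply: (@le_trans _ _ (64 * X `^ (2 * eps))).
    rewrite powRM//; last exact: ltW.
    rewrite ler_wpM2r ?powR_ge0//; apply: (@le_trans _ _ (8 `^ 2%:R)).
      by apply: ler_powR; rewrite ?ler1n//; lra.
    by rewrite powR_mulrn// expr2; lra.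
  have := ler_wpM2l (ltW c0) (le_trans pX Xh); rewrite !mulrA.
  have -> : c * 64 / c = 64 by field; rewrite gt_eqF.
  by [].
have e8 : (8 * y) `^ eps <= (8 * X) `^ eps by apply: powR_le; clear - y0 yX e_gt0; lra.
have e8' : (8 * X) `^ eps <= (8 * X) `^ (2 * eps).
  by apply: ler_powR; clear - X8 e_gt0; lra.
have range : delta_range eps (8 * y) (3 * (c * h / y)).
  have y80 : 0 < 8 * y by rewrite mulr_gt0.
  have chy : 3 * (c * h / y) = 24 * (c * h) / (8 * y) by field; rewrite gt_eqF.
  apply/andP; split.
    rewrite powRD_gt0// powRN powRr1 ?(ltW y80)// chy mulrC.
    by rewrite ler_wpM2r ?invr_ge0 ?(ltW y80)//; clear - e8 e8' e2 u0; lra.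
  rewrite mulrA ler_pdivrMr//.
  have : c * h <= 1 * h by rewrite ler_wpM2r// ltW.
  have : 8^-1 * y `^ (- eps) <= (8 * y) `^ (- eps).
    rewrite powRM ?(ltW y0)// ler_wpM2r ?powR_ge0// -powR_inv1//.
    by apply: ler_powR; clear - e_le; lra.
  move/(ler_wpM2r (ltW y0)).
  have : y `^ (1 - eps) = y * y `^ (- eps) by rewrite powRD_gt0// powRr1// ltW.
  clear - hy; lra.
have bsh : lbm (fun x => x + h) by apply: lbm_add; [exact: lbm_id|exact: lbm_cst].
apply: (le_trans (block_increment E_lower e_gt0 p2 K0 mom Xy y1 u0 range r1 r2 ya ab by2 bsh vP)).
rewrite -/C2; set T := Num.sqrt _.
have hL0 : 0 <= h * ln X by rewrite mulr_ge0 ?(ltW hpos)// (le_trans _ lnX).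
rewrite [T ^+ _]exprM sqr_sqrtr//.
have ln8 : ln (8 * y) <= 2 * ln X.
  have -> : 2 * ln X = ln (X * X) by rewrite lnM ?posrE//; ring.
  by rewrite ler_ln ?posrE ?mulr_gt0// ler_pM// ltW.
have ln80 : 0 <= ln (8 * y) by apply: ln_ge0; clear - y1; lra.
have q1 : (c * h * ln (8 * y)) ^+ p <= (2 ^+ p * c ^+ p) * (h * ln X) ^+ p.
  rewrite -!exprMn; apply: ge0_le_exprn; first by rewrite mulr_ge0// ltW.
  by have := ler_wpM2l (ltW u0) ln8; clear; lra.
have q2 : (8 * y) `^ eps ^+ (2 * p) <= c ^+ p * (h * ln X) ^+ p.
  rewrite -exprMn exprM; apply: ge0_le_exprn; first by rewrite exprn_ge0 ?powR_ge0.
  apply: (@le_trans _ _ (c * h)).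
    apply: le_trans e2; rewrite powR_exprn [eps * _]mulrC; apply: powR_le; clear - y0 yX e_gt0; lra.
  by rewrite mulrA ler_peMr// ltW.
have := ler_wpM2l (mulr_ge0 (ltW C20) (ltW y0)) (lerD q1 q2).
by clear; lra.
Qed.

(** [fixed_block] with c = rho = 1, summed over dyadic blocks. The descent stops somewhere in
    [a, 2a], hence the lower limit 2a. *)
Lemma fixed_moment E eps p K (X0 e1 : R) :
  (forall x y, x <= y -> E x - E y <= y - x) -> 0 < eps -> eps <= 1 / 3 -> (2 <= p)%N -> 0 <= K ->
  even_moment_bound E eps p K X0 -> 0 < e1 ->
  exists2 C : R, 0 < C &
  for_large (fun X => forall h a b,
    X `^ (2 * eps + e1) <= h -> 1 <= a -> 24 * h <= a `^ (1 - eps) -> 2 * a <= b -> b <= X ->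
    \int[mu]_(x in `[2 * a, b]) (`|E (x + h) - E x| ^+ (2 * p)) <=
      C * b * Num.sqrt (h * ln X) ^+ (2 * p)).
Proof.
move=> E_lower e_gt0 e_le p2 K0 mom e10; have [C C0 HC] := fixed_block E_lower e_gt0 e_le p2 K0 mom e10.
exists C => //; have [M HM] := HC 1 ltr01 (lexx 1); exists (Num.max M 1) => X.
rewrite ge_max => /andP[MX X1] h a b Xh a1 ha ab bX.
have X0' : 0 < X by lra.
have h0 : 0 < h by apply: lt_le_trans Xh; exact: powR_gt0.
set T := Num.sqrt _; set g := fun x => `|E (x + h) - E x| ^+ (2 * p).
have bE := lower_lipschitz_lbm E_lower.
have bg : lbm g by apply: lbm_exp; apply: lbm_norm; apply: lbm_sub => //; exact: shift_lbm h E_lower.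
have g0 x : 0 <= g x by rewrite /g exprn_ge0.
have TT : 0 <= T ^+ (2 * p) by rewrite exprn_ge0 ?sqrtr_ge0.
pose F y := \int[mu]_(x in `[1, y]) g x.
pose G y := C * y * T ^+ (2 * p).
have a0 : 0 < a by lra.
have ab' : a <= b by lra.
have r1 : 1 < 2 :> R by lra.
have step y : a <= y -> 2 * y <= b -> `|F (2 * y) - F y| <= G (2 * y) - G y.
  move=> ay yb; have y1 : 1 <= y by lra.
  have y2 : y <= 2 * y by lra.
  rewrite {1}/F (Rintegral_itv_split bg y1 y2) -/(F y) addrAC subrr add0r.
  rewrite ger0_norm ?Rintegral_itv_ge0//.
  have hy : 24 * h <= y `^ (1 - eps) by apply: (le_trans ha); apply: powR_le; clear - a0 ay e_le; lra.
  have yX : y <= X by lra.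
  have two : (1 : R) <= 2 by lra.
  have := HM X MX h y 1 y (2 * y) Xh hy y1 yX (lexx 1) two (lexx y) y2 (lexx _).
  rewrite expr1n mulr1 -/T; under eq_Rintegral do rewrite mul1r.
  rewrite -/g /G => H; apply: (le_trans (H _)); last by lra.
  by move=> x _ _; rewrite !mul1r lexx lerDl ltW.
have [y [ay yra yb Fb]] := geometric_descent r1 a0 ab' step.
have H1 := @Rintegral_itv_split _ g 1 y b bg (le_trans a1 ay) yb.
have H2 : \int[mu]_(x in `[2 * a, b]) g x <= \int[mu]_(x in `[y, b]) g x.
  by apply: Rintegral_itv_subset.
have y0 : 0 <= y by exact: le_trans (le_trans a1 ay).
have H3 : 0 <= C * y * T ^+ (2 * p) by exact: mulr_ge0 (mulr_ge0 (ltW C0) y0) TT.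
apply: (le_trans H2); move: Fb; rewrite /F H1 addrAC subrr add0r.
by rewrite ger0_norm ?Rintegral_itv_ge0// /G => Fb; apply: (le_trans Fb); clear - H3; lra.
Qed.

End FixedIncrement.

(** * Odd moments of fixed-length increments *)

Section OddMoment.
Set Implicit Arguments.
Unset Strict Implicit.
Unset Printing Implicit Defensive.
Context {R : realType}.
Implicit Types (E : R -> R) (eps x y a b c h r s w V Z K X T : R) (k n p N : nat).

Notation mu := (@lebesgue_measure R).

Definition odd_moment_small E eps n := forall eta : R, 0 < eta ->
  for_large (fun Z : R => forall d, delta_range eps Z d ->
    `|\int[mu]_(x in `[1, Z]) ((E ((1 + d) * x) - E x) ^+ n)| <=
      eta * (Z * Num.sqrt (Z * d * ln Z) ^+ n)).

(** A single ratio must be admissible at both ends of a block, whose moment is a difference of two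
    moments starting at 1; this is why [Z] may differ from [y] by a factor 2. *)
Lemma delta_range_div eps X h Z y : 0 < eps -> eps <= 1 / 3 -> 1 <= Z -> Z <= y -> y <= 2 * Z -> y <= X ->
  2 * X `^ (2 * eps) <= h -> h <= y `^ (1 - eps) -> delta_range eps Z (h / y).
Proof.
move=> e_gt0 e_le Z1 Zy yZ yX Xh hy; have Z0 : 0 < Z by lra.
have y0 : 0 < y by lra.
apply/andP; split.
  rewrite powRD_gt0// powRN powRr1 ?(ltW Z0)// mulrC.
  rewrite ler_pdivlMr// mulrAC ler_pdivrMr//.
  have Ze : Z `^ eps <= X `^ (2 * eps).
    apply: (@le_trans _ _ (X `^ eps)); first by apply: powR_le; lra.
    by apply: ler_powR; lra.
  have Xh2 : X `^ (2 * eps) <= h / 2 by lra.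
  have : Z `^ eps * y <= h / 2 * (2 * Z).
    by apply: ler_pM => //; [exact: powR_ge0|exact: ltW|exact: le_trans Xh2].
  clear; lra.
apply: (@le_trans _ _ (y `^ (- eps))); last by apply: powR_le_neg => //; lra.
rewrite ler_pdivrMr//; have -> : y `^ (- eps) * y = y `^ (1 - eps); last by [].
by rewrite addrC powRD_gt0// powRr1// ltW.
Qed.

(** With delta = h / ((1 + c) y) taken at the right end of the block, h - delta x vanishes there and
    is nonnegative before it, as [fixed_block] requires; at the left end it is c delta y <= c h. *)
Lemma ratio_shift c h x y : 0 < c -> 0 <= h -> 0 < y -> y <= x -> x <= (1 + c) * y ->
  (1 + h / ((1 + c) * y)) * x <= x + h <= (1 + h / ((1 + c) * y)) * x + c * h.
Proof.
move=> c0 h0 y0 yx xy; set y' := (1 + c) * y in xy *.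
have y'0 : 0 < y' by rewrite mulr_gt0//; lra.
set d := h / y'; have d0 : 0 <= d by rewrite divr_ge0// ltW.
have dy' : d * y' = h by rewrite divfK// gt_eqF.
have h1 := ler_wpM2l d0 xy; have h2 := ler_wpM2l d0 yx.
have h3 : h = d * y + c * (d * y) by rewrite -dy' /y'; ring.
have dy : d * y <= h.
  by rewrite -dy'; apply: ler_wpM2l => //; rewrite ler_peMl ?(ltW y0)//; lra.
have h4 := ler_wpM2l (ltW c0) dy.
by rewrite dy' in h1; clearbody d; apply/andP; split; lra.
Qed.

Lemma sqrt_moment_le n X h Z (d : R) : 1 <= Z -> Z <= X -> 0 <= d -> Z * d <= h ->
  Num.sqrt (Z * d * ln Z) ^+ n <= Num.sqrt (h * ln X) ^+ n.
Proof.
move=> Z1 ZX d0 Zd; have Z0 : 0 < Z by lra.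
apply: ge0_le_exprn; first exact: sqrtr_ge0.
apply: ler_wsqrtr; apply: ler_pM => //; first by rewrite mulr_ge0// ltW.
  exact: ln_ge0.
by rewrite ler_ln ?posrE//; exact: lt_le_trans ZX.
Qed.

(** The three copies of eta c y come from the fixed-ratio moment, the constant 1 in
    [exprn_perturb_scaled], and the discrepancy. The moment of order 2(n + 1) is left unevaluated:
    bounding it block by block would yield a multiple of y instead of c y, whereas left alone it is
    additive over blocks. *)
Lemma odd_moment_piece E eps n K (X0 e1 eta : R) :
  (forall x y, x <= y -> E x - E y <= y - x) -> 0 < eps -> eps <= 1 / 3 -> (0 < n)%N -> 0 <= K ->
  even_moment_bound E eps n.+1 K X0 -> odd_moment_small E eps n -> 0 < e1 -> 0 < eta ->
  exists c, [/\ 0 < c, c <= 1 & for_large (fun X => forall h y,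
    X `^ (2 * eps + e1) <= h -> 24 * h <= y `^ (1 - eps) -> 1 <= y -> (1 + c) * y <= X ->
    `|\int[mu]_(x in `[y, (1 + c) * y]) ((E (x + h) - E x) ^+ n)| <=
      Num.sqrt (h * ln X) ^+ n * (eta * (3 * (c * y) +
        (\int[mu]_(x in `[y, (1 + c) * y]) (`|E (x + h) - E x| ^+ (2 * n.+1)))
           / Num.sqrt (h * ln X) ^+ (2 * n.+1))))].
Proof.
move=> E_lower e_gt0 e_le n0 K0 mom small e10 eta0.
have [C C0 HC] := fixed_block E_lower e_gt0 e_le (n0 : (2 <= n.+1)%N) K0 mom e10.
have nk : (n < 2 * n.+1)%N by lia.
have [Cy Cy0 HCy] := exprn_perturb_scaled nk eta0.
(* The discrepancy costs Cy C c^(n+1) y; as c^(n+1) <= c^2, this choice brings it below eta c y. *)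
pose c := Num.min 1 (eta / (Cy * C + 1)).
have CC0 : 0 < Cy * C + 1 by rewrite ltr_wpDl// mulr_ge0// ltW.
have c0 : 0 < c by rewrite lt_min ltr01 divr_gt0.
have c1 : c <= 1 by rewrite ge_min lexx.
have c_eta : c * (Cy * C + 1) <= eta by rewrite -ler_pdivlMr// ge_min lexx orbT.
exists c; split => //.
(* Two moments are subtracted, each over a length at most 2y: together they give 2 * (eta c / 4) *
   2y = eta c y. *)
have eta20 : 0 < eta * c / 4 by rewrite !mulr_gt0.
have [N HN] := small _ eta20; have [M HM] := HC c c0 c1.
have lt0 : 0 < 2 * eps + e1 by lra.
have lt1 : 2 * eps < 2 * eps + e1 by lra.
have [M' HM'] := for_large_and (for_large_and (for_large_powR_le 2 lt1)
  (for_large_powR_ge (1 + `|N|) lt0)) (for_large_and (@for_large_ln_ge1 R) (for_large_ge 1)).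
exists (Num.max M M') => X; rewrite ge_max => /andP[MX /HM'[[pX NX] [lnX X1]]].
move=> h y Xh hy y1 yX.
have X0' : 0 < X by lra.
have y0 : 0 < y by lra.
have hN := le_trans NX Xh; have N0 := normr_ge0 N; have h0 : 0 < h by clear - N0 hN; lra.
have yeps : y `^ (1 - eps) <= y by apply: ler1_powR => //; clear - e_gt0; lra.
set y' := (1 + c) * y in yX *.
have cy : 0 < c * y by rewrite mulr_gt0.
have cy1 : c * y <= y by rewrite ler_piMl// ltW.
have yE : y' = y + c * y by rewrite /y' mulrDl mul1r.
have yy' : y <= y' by rewrite yE lerDl ltW.
have y'0 : 0 < y' by exact: lt_le_trans yy'.
have y'2 : y' <= 2 * y by rewrite yE; clear - cy1; lra.
have hy' : 24 * h <= y by exact: le_trans yeps.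
have Ny : N <= y by have := ler_norm N; clear - hN N0 h0 hy'; lra.
set T := Num.sqrt _.
have hL0 : 0 < h * ln X by rewrite mulr_gt0//; exact: lt_le_trans lnX.
have T0 : 0 < T by rewrite sqrtr_gt0.
pose d := h / y'; have d0 : 0 < d by rewrite divr_gt0.
have d1 : d <= 1 by rewrite ler_pdivrMr// mul1r (le_trans _ yy')//; clear - hy' h0; lra.
have dy' : y' * d = h by rewrite mulrC divfK// gt_eqF.
have range Z : y <= Z -> Z <= y' -> delta_range eps Z d.
  move=> yZ Zy; apply: (@delta_range_div eps X) => //.
  - exact: le_trans yZ.
  - by apply: (le_trans y'2); rewrite ler_wpM2l.
  - exact: le_trans Xh.
  have : y `^ (1 - eps) <= y' `^ (1 - eps).
    by apply: powR_le => //; [exact: ltW|clear - e_le; lra].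
  move: hy; clear - h0; lra.
have bE := lower_lipschitz_lbm E_lower.
have bsh := shift_lbm h E_lower.
set f := fun x => E (x + h) - E x.
pose g x := E ((1 + d) * x) - E x.
have bf : lbm f by exact: lbm_sub.
have bg : lbm g by apply: lbm_sub => //; exact: lbm_scaled.
have Mg Z : y <= Z -> Z <= y' ->
    `|\int[mu]_(x in `[1, Z]) (g x ^+ n)| <= eta * c / 4 * (2 * y * T ^+ n).
  move=> yZ Zy; apply: (le_trans (HN Z (le_trans Ny yZ) d (range Z yZ Zy))).
  have Z1 := le_trans y1 yZ.
  apply: ler_wpM2l; first exact: ltW.
  apply: ler_pM; rewrite ?exprn_ge0 ?sqrtr_ge0//; first exact: le_trans Z1.
    exact: le_trans y'2.
  apply: sqrt_moment_le => //; [exact: le_trans yX|exact: ltW|].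
  by rewrite -dy'; apply: ler_wpM2r => //; exact: ltW.
have Ig : `|\int[mu]_(x in `[y, y']) (g x ^+ n)| <= eta * (c * y) * T ^+ n.
  have bgn : lbm (fun x => g x ^+ n) by exact: lbm_exp.
  have := Rintegral_itv_split bgn y1 yy'.
  have := Mg y (lexx y) yy'; have := Mg y' yy' (lexx y').
  set I1 := \int[mu]_(x in `[1, y']) _; set I2 := \int[mu]_(x in `[1, y]) _.
  set I3 := \int[mu]_(x in `[y, y']) _ => A1 A2 IE.
  have -> : I3 = I1 - I2 by rewrite IE addrAC subrr add0r.
  apply: (le_trans (ler_normB _ _)); apply: (le_trans (lerD A1 A2)).
  by clear; lra.
have If : \int[mu]_(x in `[y, y']) (`|E (x + h) - E ((1 + d) * x)| ^+ (2 * n.+1)) <=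
    C * c ^+ n.+1 * y * T ^+ (2 * n.+1).
  apply: HM => //; [exact: le_trans yX|by rewrite lerDl ltW| |].
    by clear - d1; lra.
  by move=> x yx xy'; apply: ratio_shift => //; exact: ltW.
have Tn0 : 0 < T ^+ n by rewrite exprn_gt0.
set k := (2 * n.+1)%N in If *; have Tk0 : 0 < T ^+ k by rewrite exprn_gt0.
pose D x := `|E (x + h) - E ((1 + d) * x)| ^+ k.
have bD : lbm D by apply: lbm_exp; apply: lbm_norm; apply: lbm_sub => //; exact: lbm_scaled.
have bfk : lbm (fun x => `|f x| ^+ k) by apply: lbm_exp; exact: lbm_norm.
have bfn : lbm (fun x => f x ^+ n) by exact: lbm_exp.
have bgn : lbm (fun x => g x ^+ n) by exact: lbm_exp.
have bdiff : lbm (fun x => `|f x ^+ n - g x ^+ n|) by apply: lbm_norm; exact: lbm_sub.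
have pw x : `|f x ^+ n - g x ^+ n| <=
    T ^+ n * (eta * (1 + (T ^+ k)^-1 * `|f x| ^+ k) + Cy / T ^+ k * D x).
  have := HCy T (f x) (g x) T0; rewrite [`|g x - f x|]distrC.
  have -> : f x - g x = E (x + h) - E ((1 + d) * x) by rewrite /f /g; ring.
  by rewrite -/(D x) [_ / T ^+ k]mulrC [D x / _]mulrC mulrA.
have Idiff : \int[mu]_(x in `[y, y']) (`|f x ^+ n - g x ^+ n|) <=
    T ^+ n * (eta * ((y' - y) + (T ^+ k)^-1 * \int[mu]_(x in `[y, y']) (`|f x| ^+ k)) +
      Cy / T ^+ k * \int[mu]_(x in `[y, y']) D x).
  have b1 : lbm (fun x => (T ^+ k)^-1 * `|f x| ^+ k) by exact: lbm_scale.
  have b2 : lbm (fun x => 1 + (T ^+ k)^-1 * `|f x| ^+ k).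
    by apply: lbm_add => //; exact: lbm_cst.
  have b3 : lbm (fun x => eta * (1 + (T ^+ k)^-1 * `|f x| ^+ k)) by exact: lbm_scale.
  have b4 : lbm (fun x => Cy / T ^+ k * D x) by exact: lbm_scale.
  apply: (@le_trans _ _ (\int[mu]_(x in `[y, y'])
     (T ^+ n * (eta * (1 + (T ^+ k)^-1 * `|f x| ^+ k) + Cy / T ^+ k * D x)))).
    by apply: le_Rintegral_itv => //; apply: lbm_scale; exact: lbm_add.
  rewrite Rintegral_itvZ; last exact: lbm_add.
  rewrite Rintegral_itvD// !Rintegral_itvZ//.
  rewrite Rintegral_itvD//; last exact: lbm_cst.
  by rewrite Rintegral_itv_cst// mulr1 Rintegral_itvZ.
have Ifg : `|\int[mu]_(x in `[y, y']) (f x ^+ n)| <=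
    `|\int[mu]_(x in `[y, y']) (g x ^+ n)| +
    \int[mu]_(x in `[y, y']) (`|f x ^+ n - g x ^+ n|).
  have bfg : lbm (fun x => f x ^+ n - g x ^+ n) by exact: lbm_sub.
  have -> : \int[mu]_(x in `[y, y']) (f x ^+ n) =
      \int[mu]_(x in `[y, y']) (g x ^+ n) +
      \int[mu]_(x in `[y, y']) (f x ^+ n - g x ^+ n).
    rewrite -Rintegral_itvD//; congr (Rintegral _ _ _); apply/funext => x.
    by rewrite addrC subrK.
  apply: (le_trans (ler_normD _ _)); rewrite lerD2l.
  exact: normr_Rintegral_itv.
apply: (le_trans Ifg); rewrite -/(f _).
rewrite -/f; set If_ := \int[mu]_(x in `[y, y']) (`|f x| ^+ k) in Idiff *.
have ID : Cy / T ^+ k * \int[mu]_(x in `[y, y']) D x <= eta * (c * y).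
  apply: (@le_trans _ _ (Cy / T ^+ k * (C * c ^+ n.+1 * y * T ^+ k))).
    by apply: ler_wpM2l => //; rewrite divr_ge0// ltW.
  have -> : Cy / T ^+ k * (C * c ^+ n.+1 * y * T ^+ k) = Cy * C * c ^+ n.+1 * y.
    by field; rewrite gt_eqF.
  have cn : c ^+ n.+1 <= c * c.
    rewrite exprS ler_wpM2l ?(ltW c0)//; case: (n) n0 => // m _.
    by rewrite exprS ler_piMr ?(ltW c0)// exprn_ile1// ltW.
  have CC : 0 <= Cy * C by rewrite mulr_ge0// ltW.
  apply: (@le_trans _ _ (Cy * C * (c * c) * y)).
    by apply: ler_wpM2r; [exact: ltW|exact: ler_wpM2l].
  by have := ler_wpM2r (ltW cy) c_eta; have := mulr_ge0 (ltW c0) (ltW cy); clear; lra.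
have y'y : y' - y = c * y by rewrite yE; ring.
rewrite y'y in Idiff.
have := ler_wpM2l (ltW Tn0) ID; rewrite [If_ / _]mulrC.
by move: Idiff Ig; clear; lra.
Qed.

(** [odd_moment_piece] is summed by [geometric_descent]; only then is the even moment over the whole
    remaining range bounded, by [fixed_moment], which accounts for eta / (3 + C). The descent starts
    at 2a, where [fixed_moment] begins, so it stops below (1 + c) 2a <= 4a. *)
Lemma odd_moment_reduction E eps n K (X0 e1 eta : R) :
  (forall x y, x <= y -> E x - E y <= y - x) -> 0 < eps -> eps <= 1 / 3 -> (0 < n)%N -> 0 <= K ->
  even_moment_bound E eps n.+1 K X0 -> odd_moment_small E eps n -> 0 < e1 -> 0 < eta ->
  for_large (fun X => forall h a,
    X `^ (2 * eps + e1) <= h -> 24 * h <= a `^ (1 - eps) -> 1 <= a -> 4 * a <= X ->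
    exists y, [/\ 1 <= y, y <= 4 * a &
      `|\int[mu]_(x in `[1, X]) ((E (x + h) - E x) ^+ n) -
        \int[mu]_(x in `[1, y]) ((E (x + h) - E x) ^+ n)| <=
      eta * (X * Num.sqrt (h * ln X) ^+ n)]).
Proof.
move=> E_lower e_gt0 e_le n0 K0 mom small e10 eta0.
have [C C0 HC] := fixed_moment E_lower e_gt0 e_le (n0 : (2 <= n.+1)%N) K0 mom e10.
pose eta1 := eta / (3 + C); have C3 : 0 < 3 + C by lra.
have eta10 : 0 < eta1 by rewrite divr_gt0.
have [c [c0 c1 Hc]] := odd_moment_piece E_lower e_gt0 e_le n0 K0 mom small e10 eta10.
have [M HM] := for_large_and (for_large_and HC Hc)
  (for_large_and (@for_large_ln_ge1 R) (for_large_ge 1)).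
exists M => X /HM[[{}HC {}Hc] [lnX X1]] h a Xh ha a1 aX.
have X0' : 0 < X by lra.
have h0 : 0 < h by apply: lt_le_trans Xh; exact: powR_gt0.
set T := Num.sqrt _ in HC Hc *.
have T0 : 0 < T by rewrite sqrtr_gt0 mulr_gt0//; lra.
set k := (2 * n.+1)%N in HC Hc.
have Tk0 : 0 < T ^+ k by rewrite exprn_gt0.
have Tn0 : 0 < T ^+ n by rewrite exprn_gt0.
set f := fun x => E (x + h) - E x.
have bf : lbm f.
  by apply: lbm_sub; [exact: shift_lbm h E_lower|exact: lower_lipschitz_lbm E_lower].
have bfn : lbm (fun x => f x ^+ n) by exact: lbm_exp.
have bfk : lbm (fun x => `|f x| ^+ k) by apply: lbm_exp; exact: lbm_norm.
pose F y := \int[mu]_(x in `[1, y]) (f x ^+ n).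
pose G y := T ^+ n * (eta1 * (3 * y + (\int[mu]_(x in `[1, y]) (`|f x| ^+ k)) / T ^+ k)).
have a0 : 0 < a by lra.
have r1 : 1 < 1 + c by lra.
have aX' : 2 * a <= X by lra.
have a20 : 0 < 2 * a by lra.
have step y : 2 * a <= y -> (1 + c) * y <= X ->
    `|F ((1 + c) * y) - F y| <= G ((1 + c) * y) - G y.
  move=> ay yX; have y1 : 1 <= y by clear - a1 ay; lra.
  have y2 : y <= (1 + c) * y by rewrite ler_peMl ?(le_trans _ y1)// ltW.
  rewrite {1}/F (Rintegral_itv_split bfn y1 y2) -/(F y) addrAC subrr add0r.
  have hy : 24 * h <= y `^ (1 - eps) by apply: (le_trans ha); apply: powR_le; clear - a0 ay e_le; lra.
  apply: (le_trans (Hc h y Xh hy y1 yX)); rewrite /G.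
  rewrite (Rintegral_itv_split bfk y1 y2) -/f -/T -/k; lra.
have [y [ay yra yX Fy]] := geometric_descent r1 a20 aX' step.
have cy : c * (2 * a) <= 1 * (2 * a) by rewrite ler_wpM2r// ltW.
have y1 : 1 <= y by clear - a1 ay; lra.
exists y; split => //; first by clear - yra cy; lra.
apply: (le_trans Fy).
have If_le : \int[mu]_(x in `[y, X]) (`|f x| ^+ k) <= C * X * T ^+ k.
  apply: le_trans (HC h a X Xh a1 ha aX' (lexx X)).
  by apply: Rintegral_itv_subset.
have If_le' : (\int[mu]_(x in `[y, X]) (`|f x| ^+ k)) / T ^+ k <= C * X.
  by rewrite ler_pdivrMr.
rewrite /G (Rintegral_itv_split bfk y1 yX).
have etaE : eta1 * (3 + C) = eta by rewrite divfK// gt_eqF.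
have := ler_wpM2l (ltW (mulr_gt0 Tn0 eta10)) If_le'.
have y0 : 0 <= y by exact: le_trans y1.
have := mulr_ge0 (mulr_ge0 (ltW Tn0) (ltW eta10)) y0.
by rewrite -etaE; clear; lra.
Qed.

End OddMoment.

(** * The hypotheses restated for psi(x) - x *)

Section Hypotheses.
Set Implicit Arguments.
Unset Strict Implicit.
Unset Printing Implicit Defensive.
Context {R : realType}.
Implicit Types (eps x y h X : R) (n k p : nat).

Notation mu := (@lebesgue_measure R).

Definition psi_error x : R := psi x - x.

Lemma vonMangoldt_ge0 m : 0 <= vonMangoldt m :> R.
Proof.
rewrite /vonMangoldt; case: (primes m) => [|p [|q s]]//.
by case: p => [|p]; [rewrite ln0|apply: ln_ge0; rewrite ler1n].
Qed.

Lemma psi_error_lower x y : x <= y -> psi_error x - psi_error y <= y - x.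
Proof.
move=> xy; suff : psi x <= psi y by rewrite /psi_error; lra.
rewrite /psi (@big_cat_nat _ _ _ (Num.truncn x).+1 1 (Num.truncn y).+1)//=; last first.
  by rewrite ltnS le_truncn.
by rewrite lerDl sumr_ge0// => m _; exact: vonMangoldt_ge0.
Qed.

Lemma moment_ratioE k X (d : R) : moment_ratio k X d =
  \int[mu]_(x in `[1, X]) ((psi_error ((1 + d) * x) - psi_error x) ^+ k).
Proof.
rewrite /moment_ratio; congr (Rintegral _ _ _); apply/funext => x.
by congr (_ ^+ _); rewrite /psi_error mulrDl mul1r; ring.
Qed.

Lemma moment_fixedE k X h : moment_fixed k X h =
  \int[mu]_(x in `[1, X]) ((psi_error (x + h) - psi_error x) ^+ k).
Proof.
rewrite /moment_fixed; congr (Rintegral _ _ _); apply/funext => x.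
by congr (_ ^+ _); rewrite /psi_error; ring.
Qed.

Lemma ln_inv_delta_range eps X (d : R) : 0 < eps -> 1 <= X -> delta_range eps X d ->
  0 < d /\ 0 <= ln (1 / d) <= ln X.
Proof.
move=> e0 X1 /andP[dlo dhi]; have X0 : 0 < X by rewrite (lt_le_trans _ X1).
have d0 : 0 < d by apply: lt_le_trans dlo; exact: powR_gt0.
split => //; rewrite div1r lnV ?posrE//.
have h1 : (-1 + eps) * ln X <= ln d by rewrite -ln_powR ler_ln ?posrE ?powR_gt0.
have h2 : ln d <= - eps * ln X by rewrite -ln_powR ler_ln ?posrE ?powR_gt0.
have L := mulr_ge0 (ltW e0) (ln_ge0 X1); apply/andP; split; lra.
Qed.

Lemma powR_half_sqrt (a : R) n : 0 <= a -> a `^ (n%:R / 2) = Num.sqrt a ^+ n.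
Proof. by move=> a0; rewrite mulrC powRrM powR12_sqrt// powR_mulrn ?sqrtr_ge0. Qed.

Lemma even_moments_bound eps p : 0 < eps -> (0 < p)%N -> even_moments_hypothesis eps ->
  exists2 K : R, 0 <= K & exists X0 : R, even_moment_bound psi_error eps p K X0.
Proof.
move=> e0 p0 [A [B [C [A1 [B1 /near_pinftyP H]]]]].
have [M HM] := for_large_and H (for_large_and (@for_large_ln_ge1 R) (for_large_ge 1)).
set G := Gamma ((2 * p)%:R + 1) / (Gamma ((2 * p)%:R / 2 + 2) * 2 `^ ((2 * p)%:R / 2)) : R.
set A' := A `^ (B ^+ (2 * p)); have A'0 : 0 <= A' by exact: powR_ge0.
exists (`|G| + `|C| * A'); first by rewrite addr_ge0 ?mulr_ge0.
exists M => X d /HM[{}H [lnX X1]] range.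
have X0 : 0 < X by rewrite (lt_le_trans _ X1).
have [d0 /andP[l0 lX]] := ln_inv_delta_range e0 X1 range.
have k0 : (0 < 2 * p)%N by rewrite muln_gt0.
have kev : ~~ odd (2 * p) by rewrite oddM.
have := H _ d k0 kev range; rewrite -/G -/A'.
have -> : (2 * p)%:R / 2 = p%:R :> R by rewrite natrM; field.
rewrite moment_ratioE; under eq_Rintegral => x _.
  rewrite exprM -[_ ^+ 2]real_normK ?num_real// -exprM; over.
set I := \int[mu]_(x in _) _.
rewrite powRD_gt0// powRr1 ?(ltW X0)// !powR_mulrn ?(ltW X0) ?(ltW d0)//.
have Lp : ln X `^ (p%:R - 1) <= ln X ^+ p.
  rewrite -powR_mulrn; last by rewrite (le_trans _ lnX).
  by apply: ler_powR => //; rewrite gerBl.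
have lp : ln (1 / d) ^+ p <= ln X ^+ p by exact: ge0_le_exprn.
set S := X ^+ p * X; have S0 : 0 <= S * d ^+ p.
  by rewrite !mulr_ge0 ?exprn_ge0// ltW.
move=> HI; have := le_trans (ler_norm _) HI; rewrite lerBlDr => {}HI.
apply: (le_trans HI).
have -> : X * d * ln X = X * (d * ln X) by rewrite mulrA.
rewrite !exprMn.
have h1 : C * (A' * S * d ^+ p * ln X `^ (p%:R - 1)) <=
    `|C| * (A' * S * d ^+ p * ln X ^+ p).
  have q0 : 0 <= A' * S * d ^+ p by rewrite -mulrA mulr_ge0.
  apply: (@le_trans _ _ (`|C| * (A' * S * d ^+ p * ln X `^ (p%:R - 1)))).
    by apply: ler_wpM2r; [rewrite mulr_ge0 ?powR_ge0|exact: ler_norm].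
  by apply: ler_wpM2l => //; exact: ler_wpM2l.
have h2 : G * S * d ^+ p * ln (1 / d) ^+ p <= `|G| * (S * d ^+ p * ln X ^+ p).
  have q0 : 0 <= S * d ^+ p * ln (1 / d) ^+ p by rewrite mulr_ge0 ?exprn_ge0.
  have := ler_wpM2r q0 (ler_norm G).
  by have := ler_wpM2l (normr_ge0 G) (ler_wpM2l S0 lp); clear; lra.
move: (lerD h1 h2); rewrite /S; clear; lra.
Qed.

Lemma odd_moment_hypothesis_small eps n : 0 < eps -> odd_moment_hypothesis eps n ->
  odd_moment_small (@psi_error) eps n.
Proof.
move=> e0 H eta eta0; have /near_pinftyP[M HM] := H eta eta0.
exists (Num.max M 1) => X; rewrite ge_max => /andP[MX X1] d range.
have X0 : 0 < X by rewrite (lt_le_trans _ X1).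
have [d0 /andP[l0 lX]] := ln_inv_delta_range e0 X1 range.
rewrite -moment_ratioE; apply: (le_trans (HM X MX d range)).
apply: ler_wpM2l; first exact: ltW.
rewrite powRD_gt0// powRr1 ?(ltW X0)// [_ * X]mulrC -!mulrA; apply: ler_wpM2l; first exact: ltW.
have Xd0 : 0 <= X * d by rewrite mulr_ge0// ltW.
rewrite mulrA -!powRM ?(ltW X0) ?(ltW d0)// powR_half_sqrt; last by rewrite mulr_ge0.
apply: ge0_le_exprn; first exact: sqrtr_ge0.
by apply: ler_wsqrtr; rewrite mulrA; exact: ler_wpM2l.
Qed.

End Hypotheses.

(** * Exponent arithmetic for the upper end of the range *)

Section Exponents.
Set Implicit Arguments.
Unset Strict Implicit.
Unset Printing Implicit Defensive.
Context {R : realType}.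

(* This is where the upper end [X `^ (1 - (n / 2 + 1) * eps - 2 * eps1)] of the
   range of [h] comes from: with [m = n / 2], the part [x <= h `^ (1 - eps)^-1]
   contributes about [h `^ ((1 - eps)^-1 + m * (1 + eps))]. *)
Lemma range_exponent_lt1 (m eps eps1 : R) : 0 <= m -> 0 < eps -> eps <= 1 / 3 ->
  0 < eps1 -> 0 < 1 - (m + 1) * eps - 2 * eps1 ->
  (1 - (m + 1) * eps - 2 * eps1) * ((1 - eps)^-1 + m * eps + eps1) < 1.
Proof.
move=> m0 e0 e3 e1 pos; set e := 1 - (m + 1) * eps - 2 * eps1 in pos *.
have e'0 : 0 < 1 - eps by lra.
set q := (1 - eps)^-1; have qe : q * (1 - eps) = 1 by rewrite mulVf// gt_eqF.
have q0 : 0 < q by rewrite invr_gt0.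
have q1 : 1 <= q by rewrite -[1]invr1 lef_pV2 ?posrE//; lra.
have me : 0 <= m * eps by rewrite mulr_ge0// ltW.
(* Multiplied by 1 - eps, the left side equals 1 - eps - m eps^2 - m (m + 1) eps^2 (1 - eps). *)
have W1 : (e + 2 * eps1) * (q + m * eps) <= 1.
  have E1 : (q + m * eps) * (1 - eps) = 1 + m * eps - m * eps * eps.
    by rewrite mulrDl qe; ring.
  rewrite -(ler_pM2r e'0) mul1r -mulrA E1.
  have h1 := mulr_ge0 me (ltW e0).
  have h2 : 0 <= m * eps * eps * m by rewrite mulr_ge0.
  have h3 : 0 <= (e + 2 * eps1) * (m * eps * eps) by rewrite mulr_ge0//; lra.
  move: h1 h2 h3; rewrite /e; clear; lra.
(* Of the 2 eps1 removed from the first factor, one eps1 pays for the eps1 added to the second, and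
   the other makes the inequality strict. *)
have h4 : e * eps1 <= eps1.
  rewrite ler_piMl ?(ltW e1)// /e; have : 0 <= (m + 1) * eps by rewrite mulr_ge0 ?addr_ge0// ltW.
  by move: e1; clear; lra.
have h5 : eps1 <= eps1 * (q + m * eps) by rewrite ler_peMr ?(ltW e1)// (le_trans q1)// lerDl.
move: W1 h4 h5 e1; clear; lra.
Qed.

End Exponents.

Theorem theorem4 (R : realType) (RH : riemann_hypothesis R)
    (eps : R) (eps_gt0 : 0 < eps)
    (even_moments : even_moments_hypothesis eps)
    (n : nat) (n_odd : odd n)
    (odd_moment : odd_moment_hypothesis eps n) :
  forall eps0 : R, 0 < eps0 ->
    exists eps1 : R, 0 < eps1 < eps0 /\ odd_moment_conclusion eps eps1 n.
Proof.
move=> eps0 eps0_gt0; pose eps1 := eps0 / 2.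
have e1 : 0 < eps1 by rewrite divr_gt0.
have e10 : eps1 < eps0 by rewrite ltr_pdivrMr// ltr_pMr// ltr1n.
exists eps1; split; first by rewrite e1.
clearbody eps1; clear eps0 eps0_gt0 e10.
have n0 : (0 < n)%N by case: (n) n_odd.
have n1 : 1 <= n%:R :> R by rewrite ler1n.
set m : R := n%:R / 2; have m12 : 1 / 2 <= m by rewrite /m; lra.
have m0 : 0 <= m by lra.
set e := 1 - (m + 1) * eps - 2 * eps1.
move=> eta eta0; apply/near_pinftyP.
(* The factor 1/2 in the upper end empties the range of h even when the two exponents coincide. A
   nonempty range forces eps <= 1/3 and eps1 < 1. *)
have [empty|nonempty] := leP e (2 * eps + eps1).
  exists 1 => X X1 h; rewrite -/m -/e => /andP[h1 h2].
  have := le_trans h1 h2; have := ler_powR X1 empty.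
  have : 0 < X `^ (2 * eps + eps1) by rewrite powR_gt0// (lt_le_trans _ X1).
  clear; lra.
have me : eps / 2 <= m * eps by have := ler_wpM2r (ltW eps_gt0) m12; clear; lra.
have e_le1 : e <= 1 by rewrite /e; move: me e1 eps_gt0; clear; lra.
have eps_le : eps <= 1 / 3 by move: nonempty me e1; rewrite /e; clear; lra.
have eps1_lt : eps1 < 1 by move: nonempty me eps_gt0 e1; rewrite /e; clear; lra.
have e_gt0 : 0 < e by move: nonempty eps_gt0 e1; clear; lra.
set q := (1 - eps)^-1.
have ew := range_exponent_lt1 m0 eps_gt0 eps_le e1 e_gt0.
rewrite -/e -/q in ew; set w := q + m * eps + eps1 in ew.
have eps'0 : 0 < 1 - eps by move: eps_le; clear; lra.
have q0 : 0 < q by rewrite invr_gt0.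
have eq1 : e * q < 1.
  apply: le_lt_trans ew; apply: ler_wpM2l; first exact: ltW.
  by rewrite /w; move: me e1 eps_gt0; clear; lra.
(* The n-th power of the pointwise bound then carries h^(2 n tau) = h^eps1. *)
pose tau := eps1 / (2 * n%:R).
have n20 : 0 < 2 * n%:R :> R by rewrite mulr_gt0// ltr0n.
have tau0 : 0 < tau by rewrite divr_gt0.
have ntau : tau * (2 * n%:R) = eps1 by rewrite divfK// gt_eqF.
have tau1 : tau <= 1 / 2.
  by rewrite ler_pdivrMr//; move: n1 eps1_lt; clear; lra.
pose p := (Num.bound (eps / tau)).+2.
have eps_tau : eps <= p%:R * tau.
  rewrite -ler_pdivrMr//; apply: ltW.
  apply: lt_le_trans (archi_boundP (divr_ge0 (ltW eps_gt0) (ltW tau0))) _.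
  by rewrite ler_nat /p -addn2 leq_addr.
have p2 : (2 <= p)%N by [].
clearbody p.
have [K K0 [X0 even_p]] := even_moments_bound eps_gt0 (ltnW p2) even_moments.
have [K' K'0 [X0' even_n]] := even_moments_bound eps_gt0 (ltn0Sn n) even_moments.
have small := odd_moment_hypothesis_small eps_gt0 odd_moment.
have E_lower := @psi_error_lower R; have bE := lower_lipschitz_lbm E_lower.
(* M h^q will be 4a, where a = (24h)^q is the least point with 24h <= a^(1-eps). *)
pose M : R := 4 * 24 `^ q.
have M1 : 1 <= M.
  have : 1 <= (24 : R) `^ q by apply: powR_ge1; rewrite ?ler1n// ltW.
  by rewrite /M; clear; lra.
have [B [H pointwise]] := pointwise_increment E_lower eps_gt0 eps_le p2
  K0 even_p tau0 tau1 eps_tau M1.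
have eta20 : 0 < eta / 2 by rewrite divr_gt0.
have [N1 HN1] := odd_moment_reduction E_lower eps_gt0 eps_le n0 K'0 even_n small e1 eta20.
have lt0 : 0 < 2 * eps + eps1 by move: eps_gt0 e1; clear; lra.
(* The bound e w < 1 makes the integral over the initial part negligible, and e q < 1 ensures 4a <=
   X. *)
have [N2 HN2] := for_large_and
  (for_large_and (for_large_powR_le (M * `|B| ^+ n / (eta / 2)) ew)
                  (for_large_powR_le M eq1))
  (for_large_and (for_large_powR_ge (1 + `|H|) lt0)
                  (for_large_and (@for_large_ln_ge1 R) (for_large_ge 1))).
exists (Num.max N1 N2) => X; rewrite ge_max => /andP[/HN1 {}HN1 /HN2].
move=> [[Xw Xq] [HX [lnX X1]]] h; rewrite -/m -/e => /andP[Xh hX].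
have X_gt0 : 0 < X by rewrite (lt_le_trans _ X1).
rewrite powRr1 ?(ltW X_gt0)// in Xw Xq.
have hH := le_trans HX Xh.
have h1 : 1 <= h by apply: le_trans hH; rewrite lerDl.
have h0 : 0 < h by rewrite (lt_le_trans _ h1).
have Hh : H <= h by apply: le_trans hH; have := ler_norm H; clear; lra.
have hXe : h <= X `^ e by apply: (le_trans hX); rewrite ler_pdivrMr// ler_peMr ?powR_ge0// ler1n.
set T := Num.sqrt (h * ln X).
have -> : X * h `^ m * ln X `^ m = X * T ^+ n.
  rewrite -mulrA -powRM ?(ltW h0) ?(le_trans _ lnX)// powR_half_sqrt//.
  by rewrite mulr_ge0 ?(ltW h0) ?(le_trans _ lnX).
rewrite moment_fixedE.
pose a := (24 * h) `^ q.
have aM : 4 * a = M * h `^ q by rewrite /a powRM ?(ltW h0)// mulrA.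
have a_eps : 24 * h <= a `^ (1 - eps).
  by rewrite /a -powRrM mulVf ?gt_eqF// powRr1// mulr_ge0 ?(ltW h0).
have a1 : 1 <= a by apply: powR_ge1; [move: h1; clear; lra|exact: ltW].
have aX : 4 * a <= X.
  rewrite aM; apply: le_trans Xq; apply: ler_wpM2l; first exact: le_trans M1.
  by rewrite powRrM; apply: powR_le => //; exact: ltW.
have [y [y1 ya Fy]] := HN1 h a Xh a_eps a1 aX.
have yM : y <= M * h `^ q by rewrite -aM.
pose f x : R := psi_error (x + h) - psi_error x.
pose J := \int[lebesgue_measure]_(x in `[1, y]) (f x ^+ n).
suff HJ : `|J| <= eta / 2 * (X * T ^+ n).
  rewrite -[X in `|X|](subrK J); apply: (le_trans (ler_normD _ _)).
  by apply: (le_trans (lerD Fy HJ)); clear; lra.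
pose be := (1 + eps) / 2 + 2 * tau.
have bf : lbm f.
  by apply: lbm_sub => //; exact: shift_lbm.
apply: (le_trans (normr_Rintegral_itv _ _ (lbm_exp n bf))).
apply: (@le_trans _ _ (\int[lebesgue_measure]_(x in `[1, y]) ((`|B| * h `^ be) ^+ n))).
  apply: le_Rintegral_itv; [exact: lbm_norm (lbm_exp n bf)|exact: lbm_cst|].
  move=> x x1 xy; rewrite normrX; apply: ge0_le_exprn => //.
  apply: (le_trans (pointwise x h Hh x1 (le_trans xy yM))).
  by apply: ler_wpM2r; [exact: powR_ge0|exact: ler_norm].
rewrite Rintegral_itv_cst//.
(* The factor h^m is at most T^n; the excess h^(m eps + eps1) joins h^q, the length of the interval
   up to a constant, into h^w <= X^(e w), which is o(X). *)
apply: (@le_trans _ _ (M * h `^ q * (`|B| ^+ n * (h `^ m * h `^ (m * eps + eps1))))).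
  apply: ler_pM; first by rewrite subr_ge0.
  - by rewrite exprn_ge0// mulr_ge0 ?powR_ge0.
  - by apply: le_trans yM; rewrite gerBl.
  rewrite exprMn; apply: ler_wpM2l; first exact: exprn_ge0.
  rewrite -powRD_gt0// powR_exprn; apply: ler_powR => //.
  have -> : be * n%:R = m + m * eps + tau * (2 * n%:R) by rewrite /be /m; field.
  by rewrite ntau addrA.
have hm : h `^ m <= T ^+ n.
  rewrite powR_half_sqrt ?(ltW h0)//; apply: ge0_le_exprn; first exact: sqrtr_ge0.
  by apply: ler_wsqrtr; rewrite ler_peMr// ltW.
have hw : h `^ q * h `^ (m * eps + eps1) <= X `^ (e * w).
  rewrite -powRD_gt0// addrA -/w powRrM; apply: powR_le => //; first exact: ltW.
  by rewrite /w; move: q0 me eps_gt0 e1; clear; lra.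
have XB : M * `|B| ^+ n * X `^ (e * w) <= eta / 2 * X.
  by move: Xw; rewrite mulrAC ler_pdivrMr// [X * _]mulrC.
have MB0 : 0 <= M * `|B| ^+ n by rewrite mulr_ge0 ?exprn_ge0// (le_trans _ M1).
have := ler_pM (mulr_ge0 MB0 (mulr_ge0 (powR_ge0 h q) (powR_ge0 h (m * eps + eps1))))
  (powR_ge0 h m) (le_trans (ler_wpM2l MB0 hw) XB) hm.
by clear; lra.
Qed.
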